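(* Fix $m,n\in\mathbb N$, let $P=(P(d))_{d\in\mathbb N}$ be as in the context, and assume $\lim_{d\to\infty}\#P(d)=\infty$. (a) If $P$ is relatively well-spread, then for every function $\psi:\mathbb Z_+^n\to\mathbb R_+$, \[\inf_{Q\ge1}\mathrm{Leb}\big(W_{1,m}^P(\Psi_Q)\big)>0\implies \mathrm{Leb}\big(W_{n,m}^P(\psi)\big)=1.\] (b) If $P$ is relatively uniformly discrete, then for every bounded function $\psi:\mathbb Z_+^n\to\mathbb R_+$, \[\inf_{Q\ge1}\mathrm{Leb}\big(W_{1,m}^P(\Psi_Q)\big)>0\implies \mathrm{Leb}\big(W_{n,m}^P(\psi)\big)=1.\] Here $\Psi_Q$ are the functions associated with $\psi$ as in the context.
   Context: Notation: $\mathbb N$ is the positive integers, $\mathbb Z_+$ the nonnegative integers, $\mathbb R_+$ the nonnegative reals. $|\cdot|$ is the maximum norm; all distances and balls $B(\mathbf x,r)$ are with respect to it, and a ball of infinite radius is all of $\mathbb R^m$. $\mathrm{Leb}$ is Lebesgue measure. For a nonzero integer vector $\mathbf q$, $\gcd(\mathbf q)$ is the gcd of its entries. Setting: for each $d\in\mathbb N$, $P(d)\subset(\mathbb R/d\mathbb Z)^m$ is a nonempty finite set; for nonzero $\mathbf q\in\mathbb Z_+^n$, $P(\mathbf q)\subset\mathbb R^m$ is the lift (full preimage in $\mathbb R^m$) of $P(\gcd(\mathbf q))$. For nonzero $\mathbf q\in\mathbb Z_+^n$ (row vector) and $r\in[0,\infty]$, $A_{n,m}^P(\mathbf q,r)=\{\mathbf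 X\in M_{n\times m}(\mathbb R):\mathbf q\mathbf X\in B(\mathbf 0,r)+P(\mathbf q)\}$, regarded as a subset of $\mathbb T^{nm}=M_{n\times m}(\mathbb R)/M_{n\times m}(\mathbb Z)$. For $\psi:\mathbb Z_+^n\to[0,\infty]$, $W_{n,m}^P(\psi)\subset\mathbb T^{nm}$ is the set of $\mathbf X$ lying in $A_{n,m}^P(\mathbf q,\psi(\mathbf q))$ for infinitely many $\mathbf q$. For $\Psi:\mathbb N\to[0,\infty]$, $W_{1,m}^P(\Psi)\subset\mathbb T^m$ is the set of $\mathbf x$ with $d\mathbf x\in B(\mathbf 0,\Psi(d))+$ (lift of $P(d)$) for infinitely many $d\in\mathbb N$. For $\psi:\mathbb Z_+^n\to\mathbb R_+$ and $Q\ge1$, $\Psi_Q(d)=\big(\sum_{\mathbf q\in\mathbb Z_+^n,\ \gcd(\mathbf q)=d,\ |\mathbf q/\gcd(\mathbf q)|\ge Q}\psi(\mathbf q)^m\big)^{1/m}\in[0,\infty]$ for $d\in\mathbb N$. Definition: $P$ is relatively uniformly discrete if there are $b,c>0$ such that for every $d\ge1$ there is $P'(d)\subset P(d)$ with $\#P'(d)\ge c\,\#P(d)$ and $|\mathbf p_1-\mathbf p_2|\ge b$ for all distinct $\mathbf p_1,\mathbf p_2$ in the lift of $P'(d)$ to $\mathbb R^m$. $P$ is relatively well-spread if moreover there is $a>0$ such that for all $d\ge1$, $|\mathbf p_1-\mathbf p_2|\ge ad/(\#P(d))^{1/m}$ for all distinct $\mathbf p_1,\mathbf p_2$ in the lift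 of $P'(d)$. *)

(* Defs.v *)
From HB Require Import structures.
From mathcomp Require Import all_boot all_order all_algebra finmap.
From mathcomp Require Import generic_quotient.
From mathcomp Require Import all_classical all_reals all_analysis.

Set Implicit Arguments.
Unset Strict Implicit.
Unset Printing Implicit Defensive.

Import Order.TTheory GRing.Theory Num.Theory.
Import numFieldNormedType.Exports.

Local Open Scope classical_set_scope.
Local Open Scope quotient_scope.
Local Open Scope ring_scope.

(* The quotient M_{n x m}(R) / d M_{n x m}(Z). Row vectors in 'rV[R]_m are     *)
(* 1 x m matrices, so (R/dZ)^m is [torus R d 1 m] and T^{nm} is               *)
(* [torus R 1 n m].                                                           *)
Section Torus.
Variables (R : realType) (d n m : nat).

Definition congr_mx (X Y : 'M[R]_(n, m)) : bool :=
  `[< exists Z : 'M[int]_(n, m), X - Y = map_mx intr Z *+ d >].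

Lemma congr_mx_refl : reflexive congr_mx.
Proof.
move=> X; apply/asboolP; exists 0; apply/matrixP => i j.
by rewrite subrr mulmxnE !mxE mul0rn.
Qed.

Lemma congr_mx_sym : symmetric congr_mx.
Proof.
suff H X Y : congr_mx X Y -> congr_mx Y X by move=> X Y; apply/idP/idP; exact: H.
move=> /asboolP[Z XYZ]; apply/asboolP; exists (- Z).
by rewrite -opprB XYZ map_mxN mulNrn.
Qed.

Lemma congr_mx_trans : transitive congr_mx.
Proof.
move=> Y X W /asboolP[Z1 XY] /asboolP[Z2 YW]; apply/asboolP.
by exists (Z1 + Z2); rewrite map_mxD mulrnDl -XY -YW addrA subrK.
Qed.

Definition congr_mx_equiv : equiv_rel 'M[R]_(n, m) :=
  EquivRel congr_mx congr_mx_refl congr_mx_sym congr_mx_trans.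

Definition torus := {eq_quot congr_mx_equiv}.

End Torus.

(* Lebesgue measure on R^k, as the k-fold product of the Lebesgue measure on  *)
(* R; R^0 is a point of mass 1.                                               *)
Fixpoint leb (R : realType) (k : nat) :
    set (k.-tuple (measurableTypeR R)) -> \bar R :=
  match k with
  | 0 => \d_([tuple])
  | k'.+1 => pushforward (lebesgue_measure \x @leb R k')%E
                         (fun z => [tuple of z.1 :: z.2])
  end.

Definition leb_mx (R : realType) (n m : nat) (A : set 'M[R]_(n, m)) : \bar R :=
  leb [set t : (n * m).-tuple (measurableTypeR R) |
        A (vec_mx (\row_k tnth t k))].

(* Measure of a subset of T^{nm}, computed in the fundamental domain          *)
(* [0,1)^{nm}.                                                                *)
Definition leb_torus (R : realType) (n m : nat) (A : set (torus R 1 n m)) :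
    \bar R :=
  leb_mx [set X : 'M[R]_(n, m) |
    (forall i j, 0 <= X i j < 1) /\ A (\pi_(torus R 1 n m) X)].

Definition gcdv (n : nat) (q : 'rV[nat]_n) : nat := \big[gcdn/0%N]_i q 0%R i.

Definition realv (R : realType) (n : nat) (q : 'rV[nat]_n) : 'rV[R]_n :=
  map_mx (fun a : nat => a%:R) q.

Section Approximation.
Variables (R : realType) (m : nat).

Definition lift_torus (d : nat) (S : {fset torus R d 1 m}) : set 'rV[R]_m :=
  [set x | (\pi_(torus R d 1 m) x) \in S].

(* The open ball. Closed balls would change the limsup sets below only by     *)
(* Lebesgue-null sets.                                                        *)
Definition ball_at0 (r : \bar R) : set 'rV[R]_m := [set x | (`|x|%:E < r)%E].

Definition thicken (r : \bar R) (S : set 'rV[R]_m) : set 'rV[R]_m :=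
  [set x + p | x in ball_at0 r & p in S].

(* [P 0] is never used. *)
Variable P : forall d : nat, {fset torus R d 1 m}.

Definition Aset (n : nat) (q : 'rV[nat]_n) (r : \bar R) : set (torus R 1 n m) :=
  [set (\pi_(torus R 1 n m) X) | X in
    [set X : 'M[R]_(n, m) |
      thicken r (lift_torus (P (gcdv q))) (realv R q *m X)]].

Definition Wset (n : nat) (psi : 'rV[nat]_n -> \bar R) : set (torus R 1 n m) :=
  [set x | infinite_set [set q | q != const_mx 0%N /\ Aset q (psi q) x]].

Definition Aset1 (d : nat) (r : \bar R) : set (torus R 1 1 m) :=
  [set (\pi_(torus R 1 1 m) x) | x in
    [set x : 'rV[R]_m | thicken r (lift_torus (P d)) (d%:R *: x)]].

Definition W1set (Psi : nat -> \bar R) : set (torus R 1 1 m) :=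
  [set x | infinite_set [set d | (0 < d)%N /\ Aset1 d (Psi d) x]].

(* Integer vectors of gcd d whose primitive part has norm at least Q. *)
Definition gcd_fiber (n : nat) (Q : R) (d : nat) : set 'rV[nat]_n :=
  [set q | [/\ q != const_mx 0%N, gcdv q = d &
               Q <= `|(gcdv q)%:R^-1 *: realv R q|] ].

Definition PsiQ (n : nat) (psi : 'rV[nat]_n -> R) (Q : R) (d : nat) : \bar R :=
  ((\esum_(q in gcd_fiber Q d) (psi q ^+ m)%:E) `^ (m%:R^-1))%E.

Definition lift_separated (d : nat) (S : {fset torus R d 1 m}) (r : R) : Prop :=
  forall p1 p2, lift_torus S p1 -> lift_torus S p2 -> p1 != p2 ->
    r <= `|p1 - p2|.

Definition relatively_uniformly_discrete : Prop :=
  exists b c : R, [/\ 0 < b, 0 < c &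
    forall d : nat, (0 < d)%N ->
      exists P' : {fset torus R d 1 m},
        [/\ (P' `<=` P d)%fset, c * #|` P d|%:R <= #|` P'|%:R &
            lift_separated P' b]].

Definition relatively_well_spread : Prop :=
  exists a b c : R, [/\ 0 < a, 0 < b, 0 < c &
    forall d : nat, (0 < d)%N ->
      exists P' : {fset torus R d 1 m},
        [/\ (P' `<=` P d)%fset, c * #|` P d|%:R <= #|` P'|%:R, lift_separated P' b &
            lift_separated P' (a * d%:R / (#|` P d|%:R `^ (m%:R^-1)))]].

End Approximation.

(* Main.v *)
(* For a primitive vector q let S(q) be the set of x in T^m such that d x lies in
   B(0, psi(d q)) + P(d) for some d >= 1. A matrix X lies in A(d q, psi(d q)) for some d
   iff qX lies in S(q), and these events are pairwise independent for distinct primitive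
   q, since (q1 X, q2 X) is equidistributed on T^(2m) for independent q1, q2.

   If the sum of |S(q)| over primitive q diverges, the second Borel-Cantelli lemma shows
   that almost every X satisfies infinitely many of the conditions. If it converges, its
   tail over |q| >= Q tends to 0. Each ball of W_1(Psi_Q), with centre p/d and radius
   Psi_Q(d)/d, has measure equal to the sum over q of those of the concentric balls of
   radii psi(d q)/d contained in S(q); hence the sum of the functions 1_{S(q)} has mean
   at least 1 on it, and Vitali's covering argument gives
   |W_1(Psi_Q)| <= 3^m sum_{|q| >= Q} |S(q)| -> 0, contradicting the hypothesis. *)
Require Import Defs.
From HB Require Import structures.
From mathcomp Require Import all_boot all_order all_algebra finmap.
From mathcomp Require Import generic_quotient.
From mathcomp Require Import all_classical all_reals all_analysis.
From mathcomp Require Import measurable_realfun.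
From mathcomp Require Import zify ring lra.

Set Implicit Arguments.
Unset Strict Implicit.
Unset Printing Implicit Defensive.

Import Order.TTheory GRing.Theory Num.Theory.
Import numFieldNormedType.Exports.

Local Open Scope classical_set_scope.
Local Open Scope ring_scope.

(** * Translation invariance of Lebesgue measure on the line *)

Section LebesgueTranslation.
Variable R : realType.
Local Notation mu := (@lebesgue_measure R).
Local Notation MR := (measurableTypeR R).

Lemma measurable_shift (t : R) : measurable_fun [set: MR] (fun x : MR => (x + t : MR)).
Proof. by apply: measurable_funD. Qed.

Lemma lebesgue_measure_shift (t : R) (A : set MR) : measurable A ->
  pushforward mu (fun x : MR => (x + t : MR)) A = mu A.
Proof.
move=> mA; apply/esym/lebesgue_measure_unique => //=; first exact: measurable_shift.
move=> ? _ [[a b]] _ <-; rewrite /pushforward.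
rewrite (_ : _ @^-1` _ = `]a - t, b - t]%classic); last first.
  by apply/seteqP; split => x /=; rewrite !in_itv/= ltrBlDr lerBrDr.
rewrite !lebesgue_measure_itv/= !lte_fin ltrD2r; case: ifP => // _.
by rewrite -!EFinB; congr EFin; ring.
Qed.

Lemma ge0_integral_shift (t a b : R) (f : R -> \bar R) :
  measurable_fun [set: MR] f -> (forall x, 0 <= f x)%E ->
  (\int[mu]_(x in `[a, b[) f (x + t)%R = \int[mu]_(x in `[(a + t)%R, (b + t)%R[) f x)%E.
Proof.
move=> mf f0; rewrite (_ : `[a, b[%classic =
    (fun x : MR => (x + t : MR)) @^-1` `[a + t, b + t[); last first.
  by apply/seteqP; split => x /=; rewrite !in_itv/= lerD2r ltrD2r.
rewrite -ge0_integral_pushforward//=; first last.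
- exact: measurable_funS mf.
- exact: measurable_shift.
apply: eq_measure_integral => //=; first exact: measurable_shift.
by move=> mt A mA _; exact: lebesgue_measure_shift.
Qed.

(** Once t is reduced modulo 1, the translation turns the domain into [t, 1 + t); periodicity moves
    the piece [1, 1 + t) back to [0, t), which completes [t, 1). *)
Lemma ge0_integral_periodic (t : R) (f : R -> \bar R) :
  measurable_fun [set: MR] f -> (forall x, 0 <= f x)%E ->
  (forall x (z : int), f (x + z%:~R) = f x) ->
  (\int[mu]_(x in `[0%R, 1%R[) f (x + t)%R = \int[mu]_(x in `[0%R, 1%R[) f x)%E.
Proof.
move=> mf f0 fper.
wlog /andP[t0 t1] : t / 0 <= t < 1.
  move=> H; rewrite -[RHS](H (t - (Num.floor t)%:~R)); last first.
    by have := floor_itv t; rewrite intrD subr_ge0 ltrBlDr [1 + _]addrC.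
  by apply: eq_integral => x _; rewrite addrA -mulrNz fper.
have mfs (A : set R) : measurable_fun A f by exact: measurable_funS mf.
have cut (a b c : R) : a <= b -> b <= c ->
    (\int[mu]_(x in `[a, c[) f x = \int[mu]_(x in `[a, b[) f x + \int[mu]_(x in `[b, c[) f x)%E.
  move=> ab bc; rewrite -ge0_integral_setU//=.
    congr (integral _ _ _); apply/seteqP; split => x /=; rewrite !in_itv/=.
      by have [xb|xb] := ltP x b => /andP[? ?]; [left|right]; apply/andP.
    by move=> [] /andP[? ?]; apply/andP; split => //; [exact: lt_le_trans bc|exact: le_trans ab _].
  - exact: mfs.
  apply/disj_setPS => x [] /=; rewrite !in_itv/= => /andP[_ xb] /andP[bx _].
  by move: xb; rewrite ltNge bx.
rewrite ge0_integral_shift// add0r (cut t 1 (1 + t)) ?(ltW t1)//; last by rewrite lerDl.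
rewrite (cut 0 t 1) ?(ltW t1)// addeC; congr (_ + _)%E.
rewrite -{1}(add0r 1) [in `[_, _[](addrC 1 t) -ge0_integral_shift//.
by apply: eq_integral => x _; rewrite -{1}[1]/(1%:~R) fper.
Qed.

End LebesgueTranslation.

(** * Lebesgue measure on the torus as a tower of probabilities *)

Section CubeMeasure.
Variable R : realType.
Local Notation mu := (@lebesgue_measure R).
Local Notation MR := (measurableTypeR R).
Local Notation unit_itv := (`[0%R, 1%R[%classic : set MR).

Lemma lebesgue_unit_itv : mu unit_itv = 1%E.
Proof. by rewrite /= lebesgue_measure_itv/= lte01 sube0. Qed.

Definition tcons k (z : MR * k.-tuple MR) : k.+1.-tuple MR := [tuple of z.1 :: z.2].

Lemma measurable_tcons k : measurable_fun [set: MR * k.-tuple MR] (@tcons k).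
Proof. exact: measurable_cons. Qed.

Lemma measurable_tcons1 k (x : MR) :
  measurable_fun [set: k.-tuple MR] (fun t => tcons (x, t)).
Proof. exact: (measurable_cons (measurable_cst x) (@measurable_id _ _ _)). Qed.

Section Step.
Variables (k : nat) (P : probability (k.-tuple MR) R).

Let slab : set (MR * k.-tuple MR) := unit_itv `*` setT.

Let measurable_slab : measurable slab.
Proof. exact: measurableX. Qed.

(** Cutting the new coordinate down to [0, 1) before pushing forward keeps the total mass equal to
    1, so that the recursion stays among probabilities. *)
Definition cube_step : set (k.+1.-tuple MR) -> \bar R :=
  fun A => mrestr (mu \x P)%E measurable_slab (@tcons k @^-1` A).

Let cube_step0 : cube_step set0 = 0%E.
Proof. by rewrite /cube_step preimage_set0 measure0. Qed.

Let cube_step_ge0 A : (0 <= cube_step A)%E.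
Proof. exact: measure_ge0. Qed.

Let cube_step_sigma_additive : semi_sigma_additive cube_step.
Proof.
have mt := @measurable_tcons k.
pose nu : {measure set _ -> \bar R} := mrestr (mu \x P)%E measurable_slab.
rewrite (_ : cube_step = pushforward nu (@tcons k))//.
exact: measure_semi_sigma_additive.
Qed.

HB.instance Definition _ := isMeasure.Build _ _ _ cube_step
  cube_step0 cube_step_ge0 cube_step_sigma_additive.

Let cube_stepT : cube_step setT = 1%E.
Proof.
rewrite /cube_step preimage_setT /mrestr setTI product_measure1E//.
  by rewrite /= lebesgue_unit_itv probability_setT mule1.
Qed.

HB.instance Definition _ := Measure_isProbability.Build _ _ _ cube_step cube_stepT.

End Step.

(* The probability on R^k carried by [0, 1)^k: Lebesgue measure of the torus. *)
Fixpoint cube (k : nat) : probability (k.-tuple MR) R :=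
  match k with
  | 0 => \d_([tuple] : 0.-tuple MR)
  | k'.+1 => cube_step (cube k')
  end.

Lemma cube0 k : cube k set0 = 0%E.
Proof. exact: measure0. Qed.

Lemma cubeS k (A : set (k.+1.-tuple MR)) :
  (cube k.+1 A = \int[mu]_(x in unit_itv) cube k [set t | A (tcons (x, t))])%E.
Proof.
rewrite [RHS]integral_mkcond; apply: eq_integral => x _ /=.
rewrite /patch; case: ifPn => [/set_mem xI|xI].
  congr (cube k _); apply/seteqP; split => t; rewrite /xsection/= inE/=; first by case.
  by split.
rewrite -[RHS](cube0 k); congr (cube k _); apply/seteqP; split => t //.
by rewrite /xsection/= inE/= => -[_ [xI' _]]; move: xI; rewrite notin_setE.
Qed.

(** The link with [leb]. Both sides unfold to the same iterated integrals, with the unit-interval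
    constraint in the set on the left and in the measure on the right; so the identity covers all
    sets, as [leb_torus] requires. *)
Lemma leb_cube k (A : set (k.-tuple MR)) :
  leb [set t | A t /\ forall i, 0 <= (tnth t i : R) < 1] = cube k A.
Proof.
elim: k A => [|k IH] A.
  by congr (\d_ _ _)%E; apply/seteqP; split => [t []//|t At]; split => // -[].
rewrite cubeS/= /pushforward [RHS]integral_mkcond; apply: eq_integral => x _ /=.
rewrite /patch; case: ifPn => [/set_mem xI|xI].
  rewrite -IH; congr (leb _); apply/seteqP; split => t /=; rewrite /xsection/= ?inE/=.
    by move=> [At ti]; split => // i; have := ti (lift ord0 i); rewrite tnthS.
  move=> [At ti]; split => // i; case: (unliftP ord0 i) => [j|] ->; rewrite ?tnthS ?tnth0//.
rewrite -[RHS](cube0 k) -IH; congr (leb _); apply/seteqP; split => t /=; last by case.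
rewrite /xsection/= ?inE/= => -[_ /(_ ord0)]; rewrite tnth0 => x01.
by move: xI; rewrite notin_setE.
Qed.

Lemma measurable_section k (A : set (k.+1.-tuple MR)) (x : MR) :
  measurable A -> measurable [set t : k.-tuple MR | A (tcons (x, t))].
Proof. by move=> mA; rewrite -[X in measurable X]setTI; exact: measurable_tcons1. Qed.

Lemma measurable_cube_section k (A : set (k.+1.-tuple MR)) : measurable A ->
  measurable_fun [set: MR] (fun x : MR => cube k [set t | A (tcons (x, t))]).
Proof.
move=> mA; have mA' : measurable (@tcons k @^-1` A).
  by rewrite -[X in measurable X]setTI; exact: measurable_tcons.
have := measurable_fun_xsection (cube k) mA'; congr (measurable_fun _ _).
apply/funext => x /=; congr (cube k _).
by apply/seteqP; split => t; rewrite /xsection/= inE.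
Qed.

Lemma cube_pow k (B : set MR) : measurable B ->
  cube k [set t | forall i, B (tnth t i)] = (fine (mu (B `&` unit_itv)) ^+ k)%:E.
Proof.
move=> mB; have muB : mu (B `&` unit_itv) \is a fin_num.
  rewrite ge0_fin_numE//; apply: (@le_lt_trans _ _ (mu unit_itv)).
    by apply: le_measure; rewrite ?inE//; exact: measurableI.
  by rewrite lebesgue_unit_itv ltry.
elim: k => [|k IH].
  by rewrite expr0/= diracE mem_set// => -[].
rewrite cubeS exprS EFinM fineK//.
rewrite (_ : \int[mu]_(x in _) _ = \int[mu]_(x in unit_itv)
    ((\1_B x)%:E * (fine (mu (B `&` unit_itv)) ^+ k)%:E))%E.
  rewrite ge0_integralZr//=.
  - by rewrite integral_indic.
  - exact/measurable_EFinP.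
  - by rewrite lee_fin exprn_ge0// fine_ge0.
apply: eq_integral => x _; rewrite indicE; have [xB|xB] := boolP (x \in B).
  rewrite mul1e -IH; congr (cube k _); apply/seteqP; split => t /=.
    by move=> Bt i; have := Bt (lift ord0 i); rewrite tnthS.
  by move=> Bt i; case: (unliftP ord0 i) => [j|] ->; rewrite ?tnthS ?tnth0//; exact: set_mem.
rewrite mul0e -(cube0 k); congr (cube k _); apply/seteqP; split => t //=.
by move=> /(_ ord0); rewrite tnth0; move: xB; rewrite notin_setE.
Qed.

Definition tadd k (t s : k.-tuple MR) : k.-tuple MR :=
  [tuple (tnth t i : R) + tnth s i | i < k].

Definition periodic k (A : set (k.-tuple MR)) : Prop :=
  forall t (z : k.-tuple int), A (tadd t (map_tuple intr z)) <-> A t.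

Lemma tadd_tcons k (x : MR) (t : k.-tuple MR) (s : k.+1.-tuple MR) :
  tadd (tcons (x, t)) s = tcons (x + thead s, tadd t [tuple of behead s]).
Proof.
apply: eq_from_tnth => i; rewrite tnth_mktuple.
case: (unliftP ord0 i) => [j|] ->; rewrite ?tnthS ?tnth0// tnth_mktuple; congr (_ + _).
by rewrite tnth_behead; congr tnth; apply/val_inj; rewrite /= inordK// ltnS.
Qed.

Lemma tadd_tcons_int k (x : MR) (t : k.-tuple MR) (z0 : int) (z : k.-tuple int) :
  tadd (tcons (x, t)) (map_tuple intr [tuple of z0 :: z]) =
  tcons (x + z0%:~R, tadd t (map_tuple intr z)).
Proof.
apply: eq_from_tnth => i; rewrite tnth_mktuple.
by case: (unliftP ord0 i) => [j|] ->; rewrite tnth_map ?tnthS ?tnth0// tnth_mktuple tnth_map.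
Qed.

Lemma tadd0 k (t : k.-tuple MR) : tadd t (map_tuple intr (nseq_tuple k 0)) = t.
Proof.
apply: eq_from_tnth => i; rewrite tnth_mktuple tnth_map.
by rewrite tnth_nseq addr0.
Qed.

Lemma measurable_tadd k (s : k.-tuple MR) :
  measurable_fun [set: k.-tuple MR] (fun t => tadd t s).
Proof.
apply/measurable_fun_tnthP => i.
rewrite (_ : _ \o _ = (fun t => tnth t i + tnth s i)); last first.
  by apply/funext => t /=; rewrite tnth_mktuple.
by apply: measurable_funD => //; exact: (measurable_tnth (T:=MR)).
Qed.

(** By induction on the dimension: the induction hypothesis moves the trailing coordinates inside
    each section, and the measure of the section, 1-periodic in the first coordinate, is handled by
    [ge0_integral_periodic]. *)
Lemma cube_shift k (A : set (k.-tuple MR)) (s : k.-tuple MR) :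
  measurable A -> periodic A -> cube k [set t | A (tadd t s)] = cube k A.
Proof.
elim: k A s => [|k IH] A s mA pA.
  by congr (cube 0 _); apply/seteqP; split => t /=; rewrite [tadd t s]tuple0 [t]tuple0.
rewrite !cubeS.
under eq_integral => x _.
  rewrite (_ : [set t | _] = [set t | A (tcons (x + thead s, tadd t [tuple of behead s]))]); last first.
    by apply/seteqP; split => t /=; rewrite tadd_tcons.
  rewrite (IH [set t | A (tcons (x + thead s, t))]); first over.
  - exact: measurable_section.
  - by move=> t z /=; have := pA (tcons (x + thead s, t)) [tuple of 0 :: z]; rewrite tadd_tcons_int addr0.
rewrite (@ge0_integral_periodic _ (thead s) (fun x => cube k [set t | A (tcons (x, t))]))//.
- exact: measurable_cube_section.
(* Padding [z] with zeros translates the first coordinate only. *)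
- move=> x z; congr (cube k _); apply/seteqP; split => t /=;
    have := pA (tcons (x, t)) [tuple of z :: nseq_tuple k 0]; rewrite tadd_tcons_int tadd0; by case.
Qed.

End CubeMeasure.

(** * Linear forms on matrices: equidistribution and independence *)

Section Rows.
Variable R : realType.
Local Notation mu := (@lebesgue_measure R).
Local Notation MR := (measurableTypeR R).

Definition rv_of m (t : m.-tuple MR) : 'rV[R]_m := \row_i (tnth t i : R).

Definition tup_of m (x : 'rV[R]_m) : m.-tuple MR := [tuple x 0 i | i < m].

Definition mx_of n m (t : (n * m).-tuple MR) : 'M[R]_(n, m) := vec_mx (rv_of t).

Lemma tup_ofK m : cancel (@tup_of m) (@rv_of m).
Proof. by move=> x; apply/rowP => i; rewrite mxE tnth_mktuple. Qed.

Lemma rv_of_tadd m (t s : m.-tuple MR) : rv_of (tadd t s) = rv_of t + rv_of s.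
Proof. by apply/rowP => i; rewrite !mxE tnth_mktuple. Qed.

Lemma mx_of_tadd n m (t s : (n * m).-tuple MR) : mx_of (tadd t s) = mx_of t + mx_of s.
Proof. by rewrite /mx_of rv_of_tadd raddfD. Qed.

Lemma mx_of_tup n m (X : 'M[R]_(n, m)) : mx_of (tup_of (mxvec X)) = X.
Proof. by rewrite /mx_of tup_ofK mxvecK. Qed.

Lemma rv_of_intr m (z : m.-tuple int) :
  rv_of (map_tuple intr z) = map_mx intr (\row_i tnth z i).
Proof. by apply/rowP => i; rewrite !mxE tnth_map. Qed.

Lemma mx_of_intr n m (z : (n * m).-tuple int) :
  mx_of (map_tuple intr z) = map_mx intr (vec_mx (\row_i tnth z i)).
Proof. by rewrite /mx_of rv_of_intr map_vec_mx. Qed.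

(** The product sigma-algebra is carried by tuples, whereas matrix algebra needs row vectors; [mset]
    and [cube_rv] transport the former to the latter. *)
Definition mset m (S : set 'rV[R]_m) : Prop := measurable (@rv_of m @^-1` S).

Definition cube_rv m (S : set 'rV[R]_m) : \bar R := cube R m (@rv_of m @^-1` S).

Definition lattice_inv m (S : set 'rV[R]_m) : Prop :=
  forall x (Z : 'rV[int]_m), S (x + map_mx intr Z) <-> S x.

Lemma lattice_inv_periodic m (S : set 'rV[R]_m) :
  lattice_inv S -> periodic (@rv_of m @^-1` S).
Proof. by move=> pS t z /=; rewrite rv_of_tadd rv_of_intr; exact: pS. Qed.

Lemma cube_rv_shift m (S : set 'rV[R]_m) (x : 'rV[R]_m) : mset S -> lattice_inv S ->
  cube_rv [set y | S (y + x)] = cube_rv S.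
Proof.
move=> mS pS; rewrite -[RHS](cube_shift (tup_of x) mS (lattice_inv_periodic pS)).
by congr (cube R m _); apply/seteqP; split => t /=; rewrite rv_of_tadd tup_ofK.
Qed.

Lemma leb_torus_cube n m (A : set (torus R 1 n m)) :
  leb_torus A = cube R (n * m) [set t | A (\pi_(torus R 1 n m)%qT (mx_of t))].
Proof.
rewrite -leb_cube /leb_torus /leb_mx; congr (leb _); apply/seteqP; split => t /=.
  move=> [X01 At]; split => // k; case/mxvec_indexP: k => i j.
  by have := X01 i j; rewrite !mxE.
move=> [At t01]; split => // i j.
by have := t01 (mxvec_index i j); rewrite !mxE.
Qed.

(** The second component is the translation averaged over in [cube_independent]; freezing it at 0
    gives the measurability of conditions on qX alone. *)
Lemma measurable_linear_form n m (q : 'rV[R]_n) :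
  measurable_fun [set: (n * m).-tuple MR * m.-tuple MR]
    (fun z => tup_of (q *m mx_of z.1 + rv_of z.2)).
Proof.
apply/measurable_fun_tnthP => j.
rewrite (_ : _ \o _ = (fun z : (n * m).-tuple MR * m.-tuple MR =>
   \sum_i (q 0 i * tnth z.1 (mxvec_index i j)) + tnth z.2 j)); last first.
  apply/funext => z /=; rewrite tnth_mktuple !mxE; congr (_ + _).
  by apply: eq_bigr => i _; rewrite !mxE.
apply: measurable_funD.
  apply: measurable_sum => i; apply: measurable_funM => //.
  exact: (measurableT_comp (measurable_tnth (T:=MR) _)).
exact: (measurableT_comp (measurable_tnth (T:=MR) _)).
Qed.

Lemma measurable_linear_preimage n m (q : 'rV[R]_n) (S : set 'rV[R]_m) : mset S ->
  measurable [set t : (n * m).-tuple MR | S (q *m mx_of t)].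
Proof.
move=> mS.
have mE : measurable [set z : (n * m).-tuple MR * m.-tuple MR |
    S (q *m mx_of z.1 + rv_of z.2)].
  rewrite (_ : [set z | _] = (fun z => tup_of (q *m mx_of z.1 + rv_of z.2)) @^-1` (@rv_of m @^-1` S)).
    by rewrite -[X in measurable X]setTI; exact: measurable_linear_form.
  by apply/seteqP; split => z /=; rewrite tup_ofK.
have := measurable_ysection (tup_of 0) mE; congr measurable; apply/seteqP.
by split => t; rewrite /ysection/= inE/= tup_ofK addr0.
Qed.

(* Both sides are unchanged when X is translated by w *m v, since this fixes q1 X and
   moves q2 X by v; averaging over v decouples the two conditions. *)
Lemma cube_independent n m (q1 q2 : 'rV[nat]_n) (w : 'cV[R]_n) (S1 S2 : set 'rV[R]_m) :
  realv R q1 *m w = 0 -> realv R q2 *m w = 1%:M ->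
  mset S1 -> lattice_inv S1 -> mset S2 -> lattice_inv S2 ->
  cube R (n * m) [set t | S1 (realv R q1 *m mx_of t) /\ S2 (realv R q2 *m mx_of t)] =
  (cube R (n * m) [set t | S1 (realv R q1 *m mx_of t)] * cube_rv S2)%E.
Proof.
move=> q1w q2w mS1 pS1 mS2 pS2.
set E1 := [set t | S1 (realv R q1 *m mx_of t)].
set E12 := [set t | _ /\ _].
have mE1 : measurable E1 by exact: measurable_linear_preimage.
have mE12 : measurable E12.
  by apply: measurableI => //; exact: measurable_linear_preimage.
pose E := [set z : (n * m).-tuple MR * m.-tuple MR |
   S1 (realv R q1 *m mx_of z.1) /\ S2 (realv R q2 *m mx_of z.1 + rv_of z.2)].
have mE : measurable E.
  rewrite (_ : E = (E1 `*` setT) `&`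
      (fun z => tup_of (realv R q2 *m mx_of z.1 + rv_of z.2)) @^-1` (@rv_of m @^-1` S2)).
    apply: measurableI; first exact: measurableX.
    by rewrite -[X in measurable X]setTI; exact: measurable_linear_form.
  by apply/seteqP; split => z; rewrite /E/= tup_ofK => -[] //= [].
(* Since q has integer entries, integer translations of X translate qX by integer vectors; this
   makes [E12] periodic. *)
have realv_int (q : 'rV[nat]_n) (Z : 'M[int]_(n, m)) :
    exists Z', realv R q *m map_mx intr Z = map_mx intr Z'.
  exists (map_mx (fun a : nat => a%:Z) q *m Z); rewrite map_mxM; congr (_ *m _).
  by apply/matrixP => i j; rewrite !mxE.
have pE12 : periodic E12.
  move=> t z; rewrite /E12/= mx_of_tadd mx_of_intr !mulmxDr.
  have [Z1 ->] := realv_int q1 (vec_mx (\row_i tnth z i)).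
  have [Z2 ->] := realv_int q2 (vec_mx (\row_i tnth z i)).
  by split=> -[/pS1 ? /pS2 ?].
have := indic_fubini_tonelli (cube R (n * m)) (cube R m) mE.
rewrite indic_fubini_tonelli_FE// indic_fubini_tonelli_GE// => FT.
(* For fixed v the section is a translate of [E12] along w v, so all these sections have the same
   measure. *)
transitivity (\int[cube R m]_v (cube R (n * m) \o ysection E) v)%E.
  rewrite (_ : _ \o _ = cst (cube R (n * m) E12)); last first.
    apply/funext => v /=; rewrite -[RHS](cube_shift (tup_of (mxvec (w *m rv_of v))) mE12 pE12).
    congr (cube _ _ _); apply/seteqP; split => t; rewrite /ysection/= inE/E/E12/=;
    by rewrite mx_of_tadd mx_of_tup !mulmxDr !mulmxA q1w q2w mul0mx mul1mx addr0.
  by rewrite integral_cst//= probability_setT mule1.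
(* For fixed X the section is empty unless X lies in [E1], and is then a translate of [S2]. *)
rewrite -FT (_ : _ \o _ = fun t => (\1_E1 t)%:E * cube_rv S2)%E; last first.
  apply/funext => t /=; rewrite indicE; have [tE|tE] := boolP (t \in E1).
    rewrite mul1e -(cube_rv_shift (realv R q2 *m mx_of t) mS2 pS2); congr (cube _ _ _).
    apply/seteqP; split => v; rewrite /xsection/= inE/E/= addrC; first by case.
    by move=> ?; split => //; exact: set_mem tE.
  rewrite mul0e -[RHS](cube0 R m); congr (cube _ _ _); apply/seteqP; split => v //.
  by rewrite /xsection/= inE/E/= => -[? _]; move: tE; rewrite notin_setE.
rewrite ge0_integralZr//=; first by rewrite integral_indic// setIT.
exact/measurable_EFinP.
Qed.

(** Equidistribution is the case of [cube_independent] in which q1 = 0 and [S1] is everything. *)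
Lemma cube_linear_preimage n m (q : 'rV[nat]_n) (w : 'cV[R]_n) (S : set 'rV[R]_m) :
  realv R q *m w = 1%:M -> mset S -> lattice_inv S ->
  cube R (n * m) [set t | S (realv R q *m mx_of t)] = cube_rv S.
Proof.
move=> qw mS pS; have q0w : realv R (0 : 'rV[nat]_n) *m w = 0.
  rewrite (_ : realv R 0 = 0) ?mul0mx//; by apply/matrixP => i j; rewrite !mxE.
have mT : mset [set: 'rV[R]_m] by exact: measurableT.
have := cube_independent q0w qw mT (fun _ _ => iff_refl _) mS pS.
rewrite (_ : [set t | setT _] = setT)// probability_setT mul1e => <-.
by congr (cube _ _ _); apply/seteqP; split => t //= [].
Qed.

End Rows.

(** * Balls of the torus: their measure and Vitali covering *)

Section TorusBoxes.
Variable R : realType.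
Local Notation mu := (@lebesgue_measure R).
Local Notation MR := (measurableTypeR R).

(* The preimage in R^m of the open ball of the torus with centre c and radius rho. *)
Definition tbox m (c : 'rV[R]_m) (rho : R) : set 'rV[R]_m :=
  [set x | forall j, exists z : int, `|x 0 j - c 0 j - z%:~R| < rho].

(** Around 1/2, an interval of radius at most 1/2 stays in [0, 1) without wrapping; all other
    centres are reached by translation. *)
Definition half_integers_nbhd (rho : R) : set R :=
  [set y : R | exists z : int, `|y - 2^-1 - z%:~R| < rho].

Lemma measurable_half_integers_nbhd rho : measurable (half_integers_nbhd rho : set MR).
Proof.
rewrite (_ : half_integers_nbhd rho = \bigcup_(z : int) ball (2^-1 + z%:~R : R) rho).
  by apply: open_measurable; apply: bigcup_open => z _; exact: ball_open.
apply/seteqP; split => y /=.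
  by move=> [z yz]; exists z => //; rewrite /ball/= distrC opprD addrA.
by move=> [z _]; rewrite /ball/= distrC opprD addrA => yz; exists z.
Qed.

Lemma half_integer_near (y rho : R) (z : int) : rho < 2^-1 -> 0 <= y < 1 ->
  - rho < y - 2^-1 - z%:~R -> y - 2^-1 - z%:~R < rho -> z = 0.
Proof.
move=> r1 /andP[y0 y1] h1 h2; have [z0|z0|//] := ltgtP z 0.
  have : (z + 1)%:~R <= (0 : R) by rewrite lerz0; lia.
  rewrite intrD -[1%:~R]/(1 : R) => zb; exfalso; lra.
have : 1%:~R <= z%:~R :> R by rewrite ler_int; lia.
rewrite -[1%:~R]/(1 : R) => zb; exfalso; lra.
Qed.

(** Below radius 1/2 only the interval with z = 0 meets [0, 1). From radius 1/2 on, that interval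
    contains (0, 1), and the point 0, possibly missed, is null. *)
Lemma lebesgue_half_integers_nbhd rho : 0 <= rho ->
  mu (half_integers_nbhd rho `&` `[0, 1[%classic) = (Num.min 1 (2 * rho))%:E.
Proof.
move=> rho0; have [r1|r1] := ltP rho 2^-1.
  rewrite (_ : _ `&` _ = (`](2^-1 - rho), (2^-1 + rho)[%classic : set R)).
    rewrite lebesgue_measure_itv/= lte_fin min_r; last by lra.
    case: ltP => [_|h]; rewrite -?EFinB; congr EFin; lra.
  apply/seteqP; split => y /=; rewrite !in_itv/=.
    move=> [[z]]; rewrite ltr_norml => /andP[h1 h2] /andP[y0 y1].
    have z0 : z = 0 by apply: (half_integer_near r1 _ h1 h2); rewrite y0.
    by move: h1 h2; rewrite z0/= subr0 => h1 h2; apply/andP; split; lra.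
  move=> /andP[h1 h2]; split; last by apply/andP; split; lra.
  by exists 0; rewrite subr0 ltr_norml; apply/andP; split; lra.
rewrite min_l; last by lra.
have sub y : 0 < y < 1 -> half_integers_nbhd rho y.
  by move=> /andP[y0 y1]; exists 0; rewrite subr0 ltr_norml; apply/andP; split; lra.
apply/eqP; rewrite eq_le; apply/andP; split.
  rewrite -[leRHS](lebesgue_unit_itv R); apply: le_measure; rewrite ?inE//.
  by apply: measurableI => //; exact: measurable_half_integers_nbhd.
have <- : mu `]0, 1[%classic = 1%E by rewrite lebesgue_measure_itv/= lte01 sube0.
apply: le_measure; rewrite ?inE//.
  by apply: measurableI => //; exact: measurable_half_integers_nbhd.
move=> y /=; rewrite !in_itv/= => /andP[y0 y1]; split; first by apply: sub; rewrite y0.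
by rewrite (ltW y0).
Qed.

Let centre m : 'rV[R]_m := const_mx 2^-1.

Lemma rv_preimage_tbox_centre m rho :
  @rv_of R m @^-1` (tbox (centre m) rho) = [set t | forall i, half_integers_nbhd rho (tnth t i)].
Proof.
by apply/seteqP; split => t /= h i; have [z] := h i; rewrite !mxE => ?; exists z.
Qed.

Lemma mset_tbox_centre m rho : mset (tbox (centre m) rho).
Proof.
rewrite /mset rv_preimage_tbox_centre.
rewrite (_ : [set t | _] = \bigcap_(i in [set: 'I_m]) ((@tnth _ MR)^~ i @^-1` half_integers_nbhd rho)).
  apply: fin_bigcap_measurable => // i _.
  rewrite -[X in measurable X]setTI; apply: (measurable_tnth (T:=MR)) => //.
  exact: measurable_half_integers_nbhd.
by apply/seteqP; split => t /= h i; [move=> _; exact: h|exact: h].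
Qed.

Lemma lattice_inv_tbox m (c : 'rV[R]_m) rho : lattice_inv (tbox c rho).
Proof.
move=> x Z; split=> h j; have [z hz] := h j; [exists (z - Z 0 j)|exists (z + Z 0 j)];
  move: hz; rewrite !mxE ?intrB ?intrD; congr (`|_| < _); ring.
Qed.

Lemma tbox_shift m (c c' : 'rV[R]_m) rho :
  tbox c rho = [set x | tbox c' rho (x + (c' - c))].
Proof.
by apply/seteqP; split=> x h j; have [z hz] := h j; exists z;
  move: hz; rewrite !mxE; congr (`|_| < _); ring.
Qed.

Lemma mset_shift m (S : set 'rV[R]_m) (x : 'rV[R]_m) : mset S -> mset [set y | S (y + x)].
Proof.
move=> mS; rewrite /mset (_ : _ @^-1` _ = (fun t => tadd t (tup_of x)) @^-1` (@rv_of R m @^-1` S)).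
  by rewrite -[X in measurable X]setTI; exact: measurable_tadd.
by apply/seteqP; split => t /=; rewrite rv_of_tadd tup_ofK.
Qed.

Lemma mset_tbox m (c : 'rV[R]_m) rho : mset (tbox c rho).
Proof. by rewrite (tbox_shift _ (centre m)); apply: mset_shift; exact: mset_tbox_centre. Qed.

Lemma cube_tbox m (c : 'rV[R]_m) rho : 0 <= rho ->
  cube_rv (tbox c rho) = (Num.min 1 (2 * rho) ^+ m)%:E.
Proof.
move=> rho0; rewrite (tbox_shift _ (centre m)) cube_rv_shift; first last.
- exact: lattice_inv_tbox.
- exact: mset_tbox_centre.
rewrite /cube_rv rv_preimage_tbox_centre cube_pow; last exact: measurable_half_integers_nbhd.
by rewrite lebesgue_half_integers_nbhd.
Qed.

Lemma tbox_triple m (c c' : 'rV[R]_m) rho rho' : rho <= rho' ->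
  tbox c rho `&` tbox c' rho' !=set0 -> tbox c rho `<=` tbox c' (3 * rho').
Proof.
move=> rr [y [yc yc']] x xc j.
have [z1 h1] := xc j; have [z2 h2] := yc j; have [z3 h3] := yc' j.
exists (z1 - z2 + z3).
rewrite (_ : _ - _ - _ = (x 0 j - c 0 j - z1%:~R) - (y 0 j - c 0 j - z2%:~R) +
  (y 0 j - c' 0 j - z3%:~R)); last by rewrite intrD intrB; ring.
rewrite (le_lt_trans (ler_normD _ _))// (le_lt_trans (lerD (ler_normB _ _) (lexx _)))//.
lra.
Qed.

Lemma sub_tbox m (c : 'rV[R]_m) rho rho' : rho <= rho' -> tbox c rho `<=` tbox c rho'.
Proof. by move=> rr x xc j; have [z hz] := xc j; exists z; exact: lt_le_trans rr. Qed.

Lemma cube_rv_le m (A B : set 'rV[R]_m) : mset A -> mset B -> A `<=` B ->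
  (cube_rv A <= cube_rv B)%E.
Proof. by move=> mA mB AB; apply: le_measure; rewrite ?inE// => t; exact: AB. Qed.

(* Vitali's covering argument: boxes are treated by decreasing radius, and one is
   selected when it misses the union of those selected before. *)
Lemma vitali_tbox m (s : seq ('rV[R]_m * R)) :
  pairwise (fun a b => b.2 <= a.2) s -> (forall a, a \in s -> 0 <= a.2) ->
  exists D : seq ('rV[R]_m * R), [/\ {subset D <= s},
    (forall S, mset S -> (\sum_(a <- D) cube_rv (S `&` tbox a.1 a.2) <= cube_rv S)%E) &
    (forall x, (exists2 a, a \in s & tbox a.1 a.2 x) ->
       exists2 a, a \in D & tbox a.1 (3 * a.2) x)].
Proof.
move=> srt s0.
(* The induction carries disjointness in integrated form: the masses of [S] on the selected boxes
   add up to at most its mass on their union. *)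
suff [D [Ds mD DS cov]] : exists D : seq ('rV[R]_m * R), [/\ {subset D <= s},
    mset [set x | exists2 a, a \in D & tbox a.1 a.2 x],
    (forall S, mset S -> (\sum_(a <- D) cube_rv (S `&` tbox a.1 a.2) <=
       cube_rv (S `&` [set x | exists2 a, a \in D & tbox a.1 a.2 x]))%E) &
    (forall x, (exists2 a, a \in s & tbox a.1 a.2 x) ->
       exists2 a, a \in D & tbox a.1 (3 * a.2) x)].
  exists D; split => // S mS; apply: le_trans (DS S mS) _.
  by apply: cube_rv_le => //; exact: measurableI.
(* The last box [b] is the smallest. If it meets a selected box, the triple of that box contains it;
   otherwise it is selected. *)
elim/last_ind: s srt s0 => [|s b IH] srt s0.
  exists nil; split => //.
  - by rewrite (_ : [set x | _] = set0); [exact: measurable0|apply/seteqP; split => x // []].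
  - by move=> S _; rewrite big_nil; exact: measure_ge0.
  - by move=> x [].
move: srt; rewrite pairwise_rcons => /andP[/allP/= le_b srt].
have [//|a sa|D [Ds mD DS cov]] := IH.
- by apply: s0; rewrite mem_rcons inE sa orbT.
have [[y [[a Da ya] yb]]|disj] :=
    pselect ([set x | exists2 a, a \in D & tbox a.1 a.2 x] `&` tbox b.1 b.2 !=set0).
  exists D; split => // [a' /Ds|x [a']]; first by rewrite mem_rcons inE orbC => ->.
  rewrite mem_rcons inE => /predU1P[-> xb|? ?]; last by apply: cov; exists a'.
  exists a => //; apply: tbox_triple (le_b _ (Ds _ Da)) _ _ xb.
  by exists y.
exists (b :: D); rewrite (_ : [set x | _] =
    tbox b.1 b.2 `|` [set x | exists2 a, a \in D & tbox a.1 a.2 x]); last first.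
  apply/seteqP; split => x /=.
    by move=> [a]; rewrite inE => /predU1P[-> ?|? ?]; [left|right; exists a].
  by move=> [xb|[a Da xa]]; [exists b; rewrite ?mem_head|exists a; rewrite // inE Da orbT].
split.
- by move=> a; rewrite mem_rcons !inE => /predU1P[->|/Ds ->]; rewrite ?eqxx ?orbT.
- by apply: measurableU => //; exact: mset_tbox.
- move=> S mS; rewrite big_cons setIUr.
  have -> : cube_rv (S `&` tbox b.1 b.2 `|` S `&` [set x | exists2 a, a \in D & tbox a.1 a.2 x]) =
     (cube_rv (S `&` tbox b.1 b.2) + cube_rv (S `&` [set x | exists2 a, a \in D & tbox a.1 a.2 x]))%E.
    apply: measureU; [apply: measurableI => //; exact: mset_tbox|exact: measurableI|].
    apply/seteqP; split => t //= -[[_ tb] [_ tD]]; apply: disj; exists (rv_of t); split => //.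
  by rewrite leeD2l// DS.
- move=> x [a]; rewrite mem_rcons inE => /predU1P[-> xb|sa xa].
    exists b; first exact: mem_head.
    by apply: sub_tbox xb; have := s0 b; rewrite mem_rcons mem_head => /(_ isT); lra.
  have [|a' Da' xa'] := cov x; first by exists a.
  by exists a' => //; rewrite inE Da' orbT.
Qed.

End TorusBoxes.

(** * The second Borel-Cantelli lemma under pairwise independence *)

Section SecondBorelCantelli.
Context d (T : measurableType d) (R : realType) (P : probability T R).
Variable G : (set T)^nat.
Hypothesis mG : forall k, measurable (G k).
Hypothesis indG : forall i j, i != j -> P (G i `&` G j) = (P (G i) * P (G j))%E.

Let p k := fine (P (G k)).

Let pE k : P (G k) = (p k)%:E.
Proof. by rewrite fineK// fin_num_measure. Qed.

Let p_ge0 k : 0 <= p k.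
Proof. exact: fine_ge0. Qed.

(* Chebyshev's inequality for the number Y of events that occur:
   s^2 1_{Y = 0} + 2 s Y <= Y^2 + s^2 with s the mean of Y. *)
Lemma no_event_le (r : seq nat) : uniq r ->
  (((\sum_(k <- r) p k) ^+ 2)%:E * P [set x | forall k, k \in r -> ~ G k x] <=
   (\sum_(k <- r) p k)%:E)%E.
Proof.
move=> ur; move sE : (\sum_(k <- r) p k) => s; set C := [set x | _].
have s0 : 0 <= s by rewrite -sE; exact: sumr_ge0.
have mC : measurable C.
  rewrite (_ : C = \bigcap_(k in [set` r]) ~` G k); last by apply/seteqP; split.
  by apply: fin_bigcap_measurable => // k _; apply: measurableC.
pose f x : \bar R := ((s ^+ 2)%:E * (\1_C x)%:E + \sum_(k <- r) (2 * s)%:E * (\1_(G k) x)%:E)%E.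
pose g x : \bar R := (\sum_(i <- r) \sum_(j <- r) (\1_(G i `&` G j) x)%:E + (s ^+ 2)%:E)%E.
have mindic A : measurable A -> measurable_fun [set: T] (fun x => (\1_A x)%:E : \bar R).
  by move=> mA; exact/measurable_EFinP.
have fg x : (f x <= g x)%E.
  pose Y : R := \sum_(k <- r) \1_(G k) x.
  have -> : f x = (s ^+ 2 * \1_C x + 2 * s * Y)%:E.
    rewrite EFinD; congr (_ + _)%E.
    by rewrite /Y big_distrr/= -[RHS]sumEFin; apply: eq_bigr => k _; rewrite EFinM.
  have -> : g x = (Y ^+ 2 + s ^+ 2)%:E.
    rewrite EFinD; congr (_ + _)%E; rewrite /Y expr2 big_distrl/= -sumEFin.
    apply: eq_bigr => i _; rewrite big_distrr/= -sumEFin; apply: eq_bigr => j _.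
    by rewrite indicI.
  rewrite lee_fin indicE; have [/set_mem xC|_] := boolP (x \in C); last first.
    by rewrite mulr0 add0r; have := sqr_ge0 (Y - s); rewrite sqrrB; lra.
  have -> : Y = 0; last by rewrite mulr0 addr0 mulr1 expr0n add0r.
  by rewrite /Y big_seq big1// => k kr; rewrite indicE memNset//; exact: xC.
have intf : (\int[P]_x f x = (s ^+ 2)%:E * P C + (2 * s ^+ 2)%:E)%E.
  rewrite ge0_integralD//=; first last.
  - apply: emeasurable_sum => k; exact/measurable_funeM/mindic.
  - by move=> x _; apply: sume_ge0 => k _; rewrite mule_ge0// lee_fin// mulr_ge0.
  - exact/measurable_funeM/mindic.
  - by move=> x _; rewrite mule_ge0// lee_fin// sqr_ge0.
  rewrite ge0_integralZl//=; [|exact: mindic|by rewrite lee_fin sqr_ge0].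
  rewrite integral_indic// setIT; congr (_ + _)%E.
  rewrite ge0_integral_sum//=; first last.
  - by move=> k x _; rewrite mule_ge0// lee_fin// mulr_ge0.
  - by move=> k; exact/measurable_funeM/mindic.
  rewrite expr2 mulrA -[in RHS]sE big_distrr/= -sumEFin sE; apply: eq_bigr => k _.
  rewrite ge0_integralZl//=; [|exact: mindic|by rewrite lee_fin mulr_ge0].
  by transitivity ((2 * s)%:E * P (G k))%E; [rewrite integral_indic// setIT|rewrite pE EFinM].
(* Off the diagonal, independence gives the products of the p i; on it, p i is enlarged to p i + (p
   i)^2. The double sum is thus at most s + s^2. *)
have intg : (\int[P]_x g x <= (s + s ^+ 2 + s ^+ 2)%:E)%E.
  rewrite ge0_integralD//=; first last.
  - by move=> x _; rewrite lee_fin sqr_ge0.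
  - by apply: emeasurable_sum => i; apply: emeasurable_sum => j; apply: mindic; exact: measurableI.
  - by move=> x _; apply: sume_ge0 => i _; apply: sume_ge0.
  rewrite integral_cst//= probability_setT mule1 EFinD leeD2r//.
  rewrite ge0_integral_sum//=; first last.
  - by move=> i x _; apply: sume_ge0.
  - by move=> i; apply: emeasurable_sum => j; apply: mindic; exact: measurableI.
  rewrite [leRHS](_ : _ = \sum_(i <- r) \sum_(j <- r) ((i == j)%:R * p i + p i * p j)%:E)%E; last first.
    have -> : s + s ^+ 2 = \sum_(i <- r) (p i + p i * s).
      by rewrite big_split/= -big_distrl/= sE expr2.
    rewrite -sumEFin big_seq [RHS]big_seq; apply: eq_bigr => i ir; rewrite sumEFin; congr EFin.
    rewrite big_split/= -big_distrr/= sE; congr (_ + _).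
    rewrite (bigD1_seq i)//= eqxx mul1r big1 ?addr0// => j /negbTE.
    by rewrite eq_sym => ->; rewrite mul0r.
  apply: lee_sum => i _; rewrite ge0_integral_sum//=; last first.
    by move=> j; apply: mindic; exact: measurableI.
  apply: lee_sum => j _; rewrite integral_indic//; last exact: measurableI.
  rewrite setIT -[leLHS]/(P (G i `&` G j)); have [<-|ij] := eqVneq i j.
    by rewrite setIid pE lee_fin mul1r lerDl mulr_ge0.
  by rewrite indG// !pE mul0r add0r EFinM.
have : (\int[P]_x f x <= \int[P]_x g x)%E.
  apply: ge0_le_integral => //.
  - move=> x _; rewrite adde_ge0//; first by rewrite mule_ge0// lee_fin// sqr_ge0.
    by apply: sume_ge0 => k _; rewrite mule_ge0// lee_fin// mulr_ge0.
  - apply: emeasurable_funD; first exact/measurable_funeM/mindic.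
    by apply: emeasurable_sum => k; exact/measurable_funeM/mindic.
  - apply: emeasurable_funD => //.
    by apply: emeasurable_sum => i; apply: emeasurable_sum => j; apply: mindic; exact: measurableI.
move=> /le_trans/(_ intg); rewrite intf -(fineK (fin_num_measure P C mC)) -EFinM -EFinD !lee_fin.
lra.
Qed.

(** By [no_event_le], the probability that no event with index in [N, M) occurs is at most 1/s,
    where the sum s over these indices grows without bound in M. *)
Lemma second_borel_cantelli : (\sum_(k <oo) P (G k) = +oo)%E -> P (lim_sup_set G) = 1%E.
Proof.
move=> sumoo.
have unbounded (N : nat) (A : R) : exists M, A <= \sum_(N <= k < M) p k.
  apply/not_existsP => bnd.
  suff : (\sum_(k <oo) P (G k) <= (\sum_(0 <= k < N) p k + `|A|)%:E)%E by rewrite sumoo.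
  apply: lime_le; first exact: is_cvg_nneseries.
  apply: nearW => M; under eq_bigr do rewrite pE; rewrite sumEFin lee_fin.
  have [MN|NM] := leqP M N.
    rewrite (big_cat_nat (leq0n M) MN)//= -addrA lerDl addr_ge0//.
    exact: sumr_ge0.
  rewrite (big_cat_nat (leq0n N) (ltnW NM))//= lerD2l.
  by have /negP := bnd M; rewrite -ltNge => /ltW/le_trans; apply; exact: ler_norm.
have mC N : measurable (\bigcap_(k in [set k | (N <= k)%N]) ~` G k).
  by apply: bigcap_measurable; [exists N => /=|move=> k _; exact: measurableC].
have C0 N : P (\bigcap_(k in [set k | (N <= k)%N]) ~` G k) = 0%E.
  apply/eqP; rewrite eq_le measure_ge0 andbT leNgt; apply/negP => c0.
  set c := fine (P (\bigcap_(k in [set k | (N <= k)%N]) ~` G k)).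
  have cE : P (\bigcap_(k in [set k | (N <= k)%N]) ~` G k) = c%:E.
    by rewrite fineK// fin_num_measure.
  move: c0; rewrite cE lte_fin => c0.
  (* A sum s > 1/c gives s^2 c > s, against [no_event_le]. *)
  have [M sM] := unbounded N (c^-1 + 1); set s := \sum_(N <= k < M) p k in sM.
  have := no_event_le (iota_uniq N (M - N)); rewrite -/(index_iota N M) -/s.
  have s_gt0 : 0 < s by rewrite (lt_le_trans _ sM)// addr_gt0// invr_gt0.
  apply/negP; rewrite -ltNge.
  apply: (@lt_le_trans _ _ ((s ^+ 2)%:E * c%:E)%E).
    rewrite -EFinM lte_fin expr2 -mulrA ltr_pMr// mulrC -ltr_pdivrMl// mulr1.
    by rewrite (lt_le_trans _ sM)// ltrDl.
  rewrite lee_wpmul2l ?lee_fin ?sqr_ge0// -cE; apply: le_measure; rewrite ?inE//.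
    rewrite (_ : [set x | _] = \bigcap_(k in [set` iota N (M - N)]) ~` G k).
      by apply: fin_bigcap_measurable => // k _; apply: measurableC.
    by apply/seteqP; split.
  by move=> x /= h k; rewrite mem_iota => /andP[Nk _]; exact: h.
have mL : measurable (lim_sup_set G).
  by apply: bigcapT_measurable => n; apply: bigcup_measurable.
suff L0 : P (~` lim_sup_set G) = 0%E.
  have := probability_setC P mL; rewrite L0 => /esym/eqP.
  by rewrite sube_eq ?add0e ?fin_num_measure// => /eqP.
apply/eqP; rewrite eq_le measure_ge0 andbT.
have -> : ~` lim_sup_set G = \bigcup_N \bigcap_(k in [set k | (N <= k)%N]) ~` G k.
  by rewrite /lim_sup_set setC_bigcap; apply: eq_bigcupr => N _; rewrite setC_bigcup.
apply: (@le_trans _ _ (\sum_(N <oo) P (\bigcap_(k in [set k | (N <= k)%N]) ~` G k))%E).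
  by apply: measure_sigma_subadditive => //; exact: bigcupT_measurable.
by rewrite eseries0.
Qed.

End SecondBorelCantelli.

(** * Primitive integer vectors and dual directions *)

Section IntegerVectors.
Variable n : nat.
Implicit Types q : 'rV[nat]_n.

Definition dilate (d : nat) q : 'rV[nat]_n := map_mx (muln d) q.

Definition primitive_part q : 'rV[nat]_n := map_mx (fun a => a %/ gcdv q)%N q.

Lemma muln_gcdv (a : nat) q : (a * gcdv q)%N = \big[gcdn/0%N]_i (a * q 0%R i)%N.
Proof. exact: (big_morph (muln a) (fun b c => muln_gcdr a b c) (muln0 a)). Qed.

Lemma gcdv_dilate d q : gcdv (dilate d q) = (d * gcdv q)%N.
Proof. by rewrite muln_gcdv; apply: eq_bigr => i _; rewrite mxE. Qed.

Lemma dvdn_gcdv q i : (gcdv q %| q 0%R i)%N.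
Proof. by rewrite /gcdv (bigD1 i)//=; exact: dvdn_gcdl. Qed.

Lemma dilate_primitive_part q : dilate (gcdv q) (primitive_part q) = q.
Proof. by apply/rowP => i; rewrite !mxE mulnC divnK// dvdn_gcdv. Qed.

Lemma gcdv_eq0 q : gcdv q = 0%N -> q = const_mx 0%N.
Proof.
move=> q0; apply/rowP => i; rewrite mxE; apply/eqP.
by have := dvdn_gcdv q i; rewrite q0 dvd0n.
Qed.

Lemma gcdv_gt0 q : (0 < gcdv q)%N = (q != const_mx 0%N).
Proof.
rewrite lt0n; congr negb; apply/eqP/eqP => [/gcdv_eq0//|->].
by rewrite /gcdv big1// => i _; rewrite mxE.
Qed.

Lemma gcdv_primitive_part q : q != const_mx 0%N -> gcdv (primitive_part q) = 1%N.
Proof.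
rewrite -gcdv_gt0 => q0; apply/eqP; rewrite -(eqn_pmul2l q0) muln1 -gcdv_dilate.
by rewrite dilate_primitive_part.
Qed.

Lemma primitive_part_dilate d q : (0 < d)%N -> gcdv q = 1%N ->
  primitive_part (dilate d q) = q.
Proof.
by move=> d0 q1; apply/rowP => i; rewrite !mxE gcdv_dilate q1 muln1 mulKn.
Qed.

Variable R : realType.

Lemma realv_dilate d q : realv R (dilate d q) = d%:R *: realv R q.
Proof. by apply/rowP => i; rewrite !mxE natrM. Qed.

Lemma realv_primitive_part q : realv R q = (gcdv q)%:R *: realv R (primitive_part q).
Proof. by rewrite -realv_dilate dilate_primitive_part. Qed.

Lemma realv_mul_delta q i (c : R) : realv R q *m (c *: delta_mx i 0) = (c * (q 0 i)%:R)%:M.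
Proof.
rewrite -scalemxAr -colE; apply/matrixP => a b.
by rewrite !ord1 !mxE eqxx mulr1n.
Qed.

Lemma exists_dual q : gcdv q = 1%N -> exists w : 'cV[R]_n, realv R q *m w = 1%:M.
Proof.
move=> q1; have [i qi] : exists i, q 0%R i != 0%N.
  apply/existsP; rewrite -negb_forall; apply/negP => /forallP q0.
  by move: q1; rewrite /gcdv big1// => i _; exact/eqP/q0.
by exists ((q 0 i)%:R^-1 *: delta_mx i 0); rewrite realv_mul_delta mulVf// pnatr_eq0.
Qed.

(** If all minors vanish, taking the gcd over j in q1_i q2_j = q1_j q2_i yields q1_i = q2_i for
    every i. *)
Lemma primitive_minor q1 q2 : gcdv q1 = 1%N -> gcdv q2 = 1%N -> q1 != q2 ->
  exists i j, (q1 0%R i * q2 0%R j != q1 0%R j * q2 0%R i)%N.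
Proof.
move=> g1 g2; apply: contraNP => minors; apply/eqP/rowP => i.
have : (q1 0%R i * gcdv q2 = q2 0%R i * gcdv q1)%N.
  rewrite !muln_gcdv; apply: eq_bigr => j _; apply/eqP; apply: contra_notT minors => h.
  by exists i, j; rewrite [X in _ != X]mulnC.
by rewrite g1 g2 !muln1.
Qed.

(** Cramer's rule on two coordinates with nonzero minor [D]. The vector w is the direction of
    translation used in [cube_independent]. *)
Lemma exists_dual_pair q1 q2 : gcdv q1 = 1%N -> gcdv q2 = 1%N -> q1 != q2 ->
  exists w : 'cV[R]_n, realv R q1 *m w = 0 /\ realv R q2 *m w = 1%:M.
Proof.
move=> g1 g2 /(primitive_minor g1 g2)[i [j minor]].
pose D : R := (q1 0 i)%:R * (q2 0 j)%:R - (q1 0 j)%:R * (q2 0 i)%:R.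
have D0 : D != 0 by rewrite subr_eq0 -!natrM eqr_nat.
exists (((q1 0 i)%:R / D) *: delta_mx j 0 - ((q1 0 j)%:R / D) *: delta_mx i 0).
rewrite !mulmxBr !realv_mul_delta -!raddfB/=; split; last by congr (_%:M); rewrite /D; field.
by rewrite (_ : _ - _ = 0) ?raddf0//; field.
Qed.

End IntegerVectors.

(** * Approximation sets as finite unions of torus balls *)

Section Thickening.
Variables (R : realType) (m : nat).
Hypothesis m_gt0 : (0 < m)%N.

Lemma norm_lt_row (x : 'rV[R]_m) r : (`|x| < r) <-> (forall j, `|x 0 j| < r).
Proof.
split=> [xr j|xr].
  apply: le_lt_trans xr; rewrite -[leRHS]/(mx_norm x) mx_normrE.
  exact: (le_bigmax _ (fun i : 'I_1 * 'I_m => `|x i.1 i.2|) (0, j)).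
rewrite -[ltLHS]/(mx_norm x) mx_normrE; apply: bigmax_lt => [|[i j] _]; last by rewrite /= ord1.
exact: le_lt_trans (xr (Ordinal m_gt0)).
Qed.

Lemma pi_eq d (x y : 'rV[R]_m) : \pi_(torus R d 1 m)%qT x = \pi_(torus R d 1 m)%qT y <->
  exists Z : 'rV[int]_m, x - y = map_mx intr Z *+ d.
Proof.
split=> [/eqP|h]; first by rewrite eqmodE => /asboolP.
by apply/eqP; rewrite eqmodE; apply/asboolP.
Qed.

Variable P : forall d : nat, {fset torus R d 1 m}.

(* The set {x | d x in B(0, r) + P(d)}, as a finite union of torus balls. *)
Definition approx_set (d : nat) (r : R) : set 'rV[R]_m :=
  [set x | exists2 p, p \in P d & tbox (d%:R^-1 *: repr p) (r / d%:R) x].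

(** Division by d carries the lattice d Z^m to Z^m and B(0, r) to B(0, r/d), so each class p of
    [P d] becomes one torus ball centred at p/d. *)
Lemma thicken_tbox d r (x : 'rV[R]_m) : (0 < d)%N ->
  thicken r%:E (lift_torus (P d)) (d%:R *: x) <-> approx_set d r x.
Proof.
move=> d0; have dR : 0 < (d%:R : R) by rewrite ltr0n.
have dN0 : (d%:R : R) != 0 by rewrite gt_eqF.
split.
  move=> [y]; rewrite /ball_at0/= lte_fin => /norm_lt_row yr [p pP ypx].
  exists (\pi_(torus R d 1 m)%qT p) => //.
  have [Z pZ] : exists Z : 'rV[int]_m, p - repr (\pi_(torus R d 1 m)%qT p) = map_mx intr Z *+ d.
    by apply/pi_eq; rewrite reprK.
  move=> j; exists (Z 0 j).
  have -> : x 0 j - (d%:R^-1 *: repr (\pi_(torus R d 1 m)%qT p)) 0 j - (Z 0 j)%:~R = y 0 j / d%:R.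
    move/rowP : ypx => /(_ j); move/rowP : pZ => /(_ j); rewrite mulmxnE !mxE => pZ ypx.
    have -> : x 0 j = (y 0 j + p 0 j) / d%:R by rewrite ypx mulrC mulKf.
    have -> : p 0 j = (Z 0 j)%:~R * d%:R + repr (\pi_(torus R d 1 m)%qT p) 0 j.
      by rewrite mulr_natr -pZ subrK.
    by field.
  by rewrite normrM normfV (gtr0_norm dR) ltr_pM2r// invr_gt0.
move=> [p pP /choice[z hz]].
pose p' : 'rV[R]_m := repr p + map_mx intr (\row_j z j) *+ d.
exists (d%:R *: x - p').
  rewrite /ball_at0/= lte_fin; apply/norm_lt_row => j.
  rewrite (_ : _ 0 j = d%:R * (x 0 j - (d%:R^-1 *: repr p) 0 j - (z j)%:~R)).
    by rewrite normrM (gtr0_norm dR) mulrC -ltr_pdivlMr.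
  by rewrite /p' !mxE mulmxnE !mxE -mulr_natr; field.
exists p'; last by rewrite subrK.
rewrite /lift_torus/= (_ : \pi_(torus R d 1 m)%qT p' = p)// -[RHS]reprK; apply/pi_eq.
by exists (\row_j z j); rewrite /p' addrC addKr.
Qed.

Lemma approx_setE d r : approx_set d r =
  \bigcup_(p in [set` P d]) tbox (d%:R^-1 *: repr p) (r / d%:R).
Proof. by apply/seteqP; split => x [p pP px]; exists p. Qed.

Lemma mset_approx_set d r : mset (approx_set d r).
Proof.
rewrite /mset approx_setE preimage_bigcup; apply: fin_bigcup_measurable.
  exact: finite_fset.
by move=> p _; exact: mset_tbox.
Qed.

Lemma lattice_inv_approx_set d r : lattice_inv (approx_set d r).
Proof.
by move=> x Z; split=> -[p pP px]; exists p => //; apply/(lattice_inv_tbox _ _ x Z).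
Qed.

Lemma thicken_lattice d (r : \bar R) (x : 'rV[R]_m) (Z : 'rV[int]_m) :
  thicken r (lift_torus (P d)) x ->
  thicken r (lift_torus (P d)) (x + map_mx intr Z *+ d).
Proof.
move=> [y yr [p pP <-]]; exists y => //; exists (p + map_mx intr Z *+ d); last by rewrite addrA.
rewrite /lift_torus/= (_ : \pi_(torus R d 1 m)%qT _ = \pi_(torus R d 1 m)%qT p)//.
by apply/pi_eq; exists Z; rewrite addrC addKr.
Qed.

(** [Aset] is an image, so the point is independence of the representative: an integer change of X
    moves qX by gcd(q) times an integer vector, which preserves the lift of P(gcd(q)). *)
Lemma Aset_pi n (q : 'rV[nat]_n) (r : \bar R) (X : 'M[R]_(n, m)) :
  Aset P q r (\pi_(torus R 1 n m)%qT X) <->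
  thicken r (lift_torus (P (gcdv q))) (realv R q *m X).
Proof.
split=> [[X' X'q /eqP]|Xq]; last by exists X.
rewrite eqmodE => /asboolP[Z XZ].
have -> : realv R q *m X = realv R q *m X' +
    map_mx intr (- (map_mx (fun a : nat => a%:Z) (primitive_part q) *m Z)) *+ gcdv q.
  rewrite -[X in _ *m X](subKr X') XZ mulr1n mulmxBr map_mxN mulNrn map_mxM; congr (_ - _).
  rewrite realv_primitive_part -scalemxAl scaler_nat; congr (_ *m _ *+ _).
  by apply/matrixP => i j; rewrite !mxE.
exact: thicken_lattice.
Qed.

Lemma Aset1_pi d (r : \bar R) (X : 'rV[R]_m) :
  Aset1 P d r (\pi_(torus R 1 1 m)%qT X) <->
  thicken r (lift_torus (P d)) (d%:R *: X).
Proof.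
split=> [[X' X'q /eqP]|Xq]; last by exists X.
rewrite eqmodE => /asboolP[Z XZ].
have -> : d%:R *: X = d%:R *: X' + map_mx intr (- Z) *+ d.
  by rewrite -[X in _ *: X](subKr X') XZ mulr1n scalerBr map_mxN mulNrn !scaler_nat.
exact: thicken_lattice.
Qed.

End Thickening.

(** * Sums over index sets, limsup sets over countable types, truncated radii *)

Lemma sub_esum (R : realType) (I : choiceType) (A B : set I) (a : I -> \bar R) :
  A `<=` B -> (\esum_(i in A) a i <= \esum_(i in B) a i)%E.
Proof.
move=> AB; apply: ge_ereal_sup => _ [X [finX XA] <-]; apply: ereal_sup_ubound.
by exists X => //; split=> //; exact: subset_trans AB.
Qed.

(** Codes are injective, so only finitely many indices have a code below a given bound. This turns
    limsup sets over integer vectors into limsup sets over naturals. *)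
Lemma infinite_pickleP (I : countType) (A : set I) :
  infinite_set A <-> forall N, exists2 i, A i & (N <= choice.pickle i)%N.
Proof.
split=> [infA N|h finA].
  apply/not_exists2P => small; apply: infA.
  apply: (@sub_finite_set _ _ (choice.pickle @^-1` `I_N)).
    by move=> i Ai /=; have [//|/negP] := small i; rewrite -ltnNge.
  by apply: finite_preimage => // i j _ _; exact: (pcan_inj choice.pickleK).
have [i Ai] := h (\max_(i <- fset_set A) choice.pickle i).+1.
apply/negP; rewrite -leqNgt.
by apply: leq_bigmax_seq => //; rewrite in_fset_set// inE.
Qed.

(** The set is a limsup along codes; at most one index has code k, so each inner set is some [F i]
    or empty. *)
Lemma measurable_infinitely_often d (T : measurableType d) (I : countType)
    (F : I -> set T) (J : set I) : (forall i, J i -> measurable (F i)) ->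
  measurable [set t | infinite_set [set i | J i /\ F i t]].
Proof.
move=> mF; rewrite (_ : [set t | _] = \bigcap_N \bigcup_k
    [set t | exists2 i, choice.pickle i = k & [/\ (N <= k)%N, J i & F i t]]); last first.
  apply/seteqP; split => t /=.
    move=> /infinite_pickleP h N _; have [i [Ji Fi] Ni] := h N.
    by exists (choice.pickle i) => //; exists i.
  move=> h; apply/infinite_pickleP => N; have [k _ [i ik [Nk Ji Fi]]] := h N Logic.I.
  by exists i; rewrite ?ik.
apply: bigcapT_measurable => N; apply: bigcupT_measurable => k.
have [[i ik [Nk Ji]]|no] := pselect (exists2 i, choice.pickle i = k & (N <= k)%N /\ J i).
  rewrite (_ : [set t | _] = F i); first exact: mF.
  apply/seteqP; split => t /=; last by exists i.
  by move=> [j jk [_ _]]; rewrite (pcan_inj choice.pickleK (etrans jk (esym ik))).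
rewrite (_ : [set t | _] = set0); first exact: measurable0.
by apply/seteqP; split => t //= [i ik [? ? _]]; apply: no; exists i.
Qed.

(** The covering constant 3^m survives truncation at full measure because min(1, 3x) <= 3 min(1,
    x). *)
Lemma min1_tripling (R : realType) (m : nat) (rho : R) : 0 <= rho ->
  Num.min 1 (2 * (3 * rho)) ^+ m <= 3 ^+ m * Num.min 1 (2 * rho) ^+ m.
Proof.
move=> r0; rewrite -exprMn lerXn2r ?nnegrE//.
- by rewrite le_min ler01/= !mulr_ge0.
- by rewrite mulr_ge0// le_min ler01/= mulr_ge0.
- by rewrite minr_pMr//= le_min !ge_min; apply/andP; split; apply/orP; [left|right]; lra.
Qed.

(** * The covering estimate for finite families of balls *)

Section Covering.
Variables (R : realType) (m : nat).

Lemma cube_rv_exists_le (I : eqType) (D : seq I) (F : I -> set 'rV[R]_m) :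
  (forall a, mset (F a)) ->
  mset [set x | exists2 a, a \in D & F a x] /\
  (cube_rv [set x | exists2 a, a \in D & F a x] <= \sum_(a <- D) cube_rv (F a))%E.
Proof.
move=> mF; elim: D => [|b D [mD IH]].
  rewrite big_nil (_ : [set x | _] = set0); last by apply/seteqP; split => x // [].
  by split; [exact: (@measurable0 _ (m.-tuple (measurableTypeR R)))|rewrite /cube_rv preimage_set0 cube0].
rewrite (_ : [set x | _] = F b `|` [set x | exists2 a, a \in D & F a x]); last first.
  apply/seteqP; split => x /=.
    by move=> [a]; rewrite inE => /predU1P[-> ?|? ?]; [left|right; exists a].
  by move=> [xb|[a Da xa]]; [exists b; rewrite ?mem_head|exists a; rewrite // inE Da orbT].
split; first exact: (measurableU _ _ (mF b) mD).
rewrite big_cons; apply: le_trans (leeD2l _ IH).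
exact: (measureU2 (cube R m) (mF b) mD).
Qed.

(* A weak-type maximal inequality: boxes on which the functions 1_{T k} have total
   mean at least 1 cover at most 3^m times the total mass of these functions. *)
Lemma covering_le (s : seq ('rV[R]_m * R)) (K : set nat) (T : nat -> set 'rV[R]_m) :
  (forall k, mset (T k)) -> (forall a, a \in s -> 0 <= a.2) ->
  (forall a, a \in s ->
     cube_rv (tbox a.1 a.2) <= \esum_(k in K) cube_rv (T k `&` tbox a.1 a.2))%E ->
  (cube_rv [set x | exists2 a, a \in s & tbox a.1 a.2 x] <=
    (3 ^+ m)%:E * \esum_(k in K) cube_rv (T k))%E.
Proof.
move=> mT s0 dense.
pose r (a b : 'rV[R]_m * R) := b.2 <= a.2.
have rtotal : total r by move=> a b; exact: le_total.
have rtrans : transitive r by move=> a b c h1 h2; exact: le_trans h2 h1.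
have mem_s a : (a \in sort r s) = (a \in s) by rewrite mem_sort.
have [||D [Ds disj cov]] := @vitali_tbox R m (sort r s).
- by rewrite -sorted_pairwise//; exact: sort_sorted.
- by move=> a; rewrite mem_s; exact: s0.
have mbox (c : R) a : mset (tbox a.1 (c * a.2) : set 'rV[R]_m) by exact: mset_tbox.
have mbox1 a : mset (tbox a.1 a.2 : set 'rV[R]_m) by exact: mset_tbox.
have [m1 _] := cube_rv_exists_le s mbox1.
have [m3 le3] := cube_rv_exists_le D (mbox 3).
apply: (@le_trans _ _ (cube_rv [set x | exists2 a, a \in D & tbox a.1 (3 * a.2) x])).
  apply: cube_rv_le => // x [a sa xa]; apply: cov; exists a => //.
  by rewrite mem_s.
apply: (le_trans le3).
(* Each tripled box costs a factor 3^m, and [dense] then bounds the original box. *)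
apply: (@le_trans _ _ (\sum_(a <- D) (3 ^+ m)%:E * \esum_(k in K) cube_rv (T k `&` tbox a.1 a.2))%E).
  rewrite big_seq [leRHS]big_seq; apply: lee_sum => a Da.
  have sa : a \in s by rewrite -mem_s; exact: Ds.
  apply: le_trans (lee_wpmul2l _ (dense a sa)); last by rewrite lee_fin exprn_ge0.
  rewrite !cube_tbox ?s0// ?mulr_ge0 ?s0// -EFinM lee_fin; exact/min1_tripling/s0.
rewrite -ge0_sume_distrr; last by move=> a _; apply: esum_ge0 => k _; exact: measure_ge0.
(* Once the two sums are exchanged, [disj] bounds the total mass of [T k] on the selected boxes by
   that of [T k]. *)
rewrite lee_wpmul2l ?lee_fin ?exprn_ge0// -esum_sum; last by move=> k a _ _; exact: measure_ge0.
by apply: le_esum => k _; exact: disj.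
Qed.

End Covering.

(** * From shadows of primitive vectors to matrices: the divergence case *)

Section Transference.
Variables (R : realType) (m n : nat).
Hypothesis m_gt0 : (0 < m)%N.
Variable P : forall d : nat, {fset torus R d 1 m}.
Variable psi : 'rV[nat]_n -> R.
Hypothesis psi_ge0 : forall q, 0 <= psi q.
Local Notation MR := (measurableTypeR R).

(* For primitive q, a matrix X lies in A(d q, psi (d q)) for some d iff qX lies in
   [shadow q]. *)
Definition shadow (q : 'rV[nat]_n) : set 'rV[R]_m :=
  [set x | exists2 d, (0 < d)%N & approx_set P d (psi (dilate d q)) x].

Lemma mset_shadow q : mset (shadow q).
Proof.
rewrite /mset (_ : _ @^-1` _ = \bigcup_(d in [set d | (0 < d)%N])
   (@rv_of R m @^-1` approx_set P d (psi (dilate d q)))).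
  by apply: bigcup_measurable => d _; exact: mset_approx_set.
by apply/seteqP; split => t /= [d d0 h]; exists d.
Qed.

Lemma lattice_inv_shadow q : lattice_inv (shadow q).
Proof.
by move=> x Z; split=> -[d d0 h]; exists d => //; apply/(lattice_inv_approx_set _ _ _ x Z).
Qed.

(** Indexing by codes makes the shadows a sequence, as Borel-Cantelli requires; a number that codes
    no primitive vector contributes the empty set. *)
Definition shadow_at (k : nat) : set 'rV[R]_m :=
  [set x | exists q, [/\ choice.pickle q = k, gcdv q = 1%N & shadow q x]].

Definition pullback_at (k : nat) : set ((n * m).-tuple MR) :=
  [set t | exists q, [/\ choice.pickle q = k, gcdv q = 1%N & shadow q (realv R q *m mx_of t)]].

Lemma at_pickle q : gcdv q = 1%N ->
  shadow_at (choice.pickle q) = shadow q /\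
  pullback_at (choice.pickle q) = [set t | shadow q (realv R q *m mx_of t)].
Proof.
move=> q1; split; apply/seteqP; split => x /=; try by exists q.
  by move=> [q' [/(pcan_inj choice.pickleK) ->]].
by move=> [q' [/(pcan_inj choice.pickleK) ->]].
Qed.

Lemma at_cases k : (exists2 q : 'rV[nat]_n, gcdv q = 1%N & choice.pickle q = k) \/
  (shadow_at k = set0 /\ pullback_at k = set0).
Proof.
case: (pselect (exists2 q : 'rV[nat]_n, gcdv q = 1%N & choice.pickle q = k)) => [|no]; first by left.
by right; split; apply/seteqP; split => x // [q [qk q1 _]]; apply: no; exists q.
Qed.

Lemma mset_shadow_at k : mset (shadow_at k).
Proof.
have [[q q1 <-]|[-> _]] := at_cases k; last exact: (@measurable0 _ (m.-tuple MR)).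
by rewrite (at_pickle q1).1; exact: mset_shadow.
Qed.

Lemma measurable_pullback_at k : measurable (pullback_at k).
Proof.
have [[q q1 <-]|[_ ->]] := at_cases k; last exact: measurable0.
by rewrite (at_pickle q1).2; apply: measurable_linear_preimage; exact: mset_shadow.
Qed.

Lemma cube_pullback_at k : cube R (n * m) (pullback_at k) = cube_rv (shadow_at k).
Proof.
have [[q q1 <-]|[-> ->]] := at_cases k; last by rewrite /cube_rv preimage_set0 !cube0.
rewrite (at_pickle q1).1 (at_pickle q1).2; have [w qw] := exists_dual R q1.
exact: cube_linear_preimage qw (mset_shadow q) (lattice_inv_shadow q).
Qed.

Lemma pullback_at_independent i j : i != j ->
  cube R (n * m) (pullback_at i `&` pullback_at j) =
  (cube R (n * m) (pullback_at i) * cube R (n * m) (pullback_at j))%E.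
Proof.
have [[q1 g1 <-]|[_ ->]] := at_cases i; last by rewrite set0I cube0 mul0e.
have [[q2 g2 <-]|[_ ->]] := at_cases j; last by rewrite setI0 cube0 mule0.
move=> q12; have {}q12 : q1 != q2 by apply: contraNneq q12 => ->.
rewrite [in RHS](cube_pullback_at (choice.pickle q2)).
rewrite (at_pickle g1).2 (at_pickle g2).2 (at_pickle g2).1.
have [w [w1 w2]] := exists_dual_pair R g1 g2 q12.
exact: (cube_independent w1 w2 (mset_shadow q1) (lattice_inv_shadow q1)
  (mset_shadow q2) (lattice_inv_shadow q2)).
Qed.

Lemma thicken_primitive_part q (X : 'M[R]_(n, m)) : q != const_mx 0%N ->
  thicken (psi q)%:E (lift_torus (P (gcdv q))) (realv R q *m X) <->
  approx_set P (gcdv q) (psi q) (realv R (primitive_part q) *m X).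
Proof.
rewrite -gcdv_gt0 => q0; rewrite realv_primitive_part -scalemxAl.
exact: thicken_tbox.
Qed.

Lemma Wset_full_of_divergence :
  (\sum_(k <oo) cube_rv (shadow_at k) = +oo)%E ->
  leb_torus (Wset P (fun q => (psi q)%:E)) = 1%E.
Proof.
move=> sumoo; have limsup1 : cube R (n * m) (lim_sup_set pullback_at) = 1%E.
  apply: second_borel_cantelli.
  - exact: measurable_pullback_at.
  - exact: pullback_at_independent.
  - by rewrite -[RHS]sumoo; apply: eq_eseriesr => k _; exact: cube_pullback_at.
rewrite leb_torus_cube; set W := [set t | _].
have WE : W = [set t | infinite_set [set q | q != const_mx 0%N /\
    [set t | approx_set P (gcdv q) (psi q) (realv R (primitive_part q) *m mx_of t)] t]].
  apply/seteqP; split => t; rewrite /W/Wset/=; apply: contra_not; apply: sub_finite_set => q /= [q0].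
    by move=> /Aset_pi/(thicken_primitive_part _ q0).
  by move=> /(thicken_primitive_part _ q0) h; split => //; apply/Aset_pi.
have mW : measurable W.
  rewrite WE; apply: measurable_infinitely_often => q _.
  by apply: measurable_linear_preimage; exact: mset_approx_set.
apply/eqP; rewrite eq_le probability_le1//= -[leLHS]limsup1; apply: le_measure; rewrite ?inE//.
  apply: bigcapT_measurable => N; apply: bigcup_measurable => k _.
  exact: measurable_pullback_at.
move=> t ht; rewrite WE/=.
(* Infinitude is counted through primitive parts: a limsup point satisfies the conditions of
   infinitely many primitive q, and each of these is the primitive part of an admissible d q. *)
suff : infinite_set (@primitive_part n @` [set q | q != const_mx 0%N /\
    approx_set P (gcdv q) (psi q) (realv R (primitive_part q) *m mx_of t)]).
  by apply: contra_not; exact: finite_image.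
apply/infinite_pickleP => N; have [k /= Nk [q [qk q1 [d d0 hq]]]] := ht N Logic.I.
exists q; last by rewrite qk.
exists (dilate d q); last exact: primitive_part_dilate.
split; first by rewrite -gcdv_gt0 gcdv_dilate q1 muln1.
by rewrite primitive_part_dilate// gcdv_dilate q1 muln1.
Qed.

End Transference.

(** * The convergence case: W_1(Psi_Q) against a tail of shadow masses *)

Section Convergence.
Variables (R : realType) (m n : nat).
Hypothesis m_gt0 : (0 < m)%N.
Variable P : forall d : nat, {fset torus R d 1 m}.
Hypothesis P_neq0 : forall d : nat, (0 < d)%N -> P d != fset0.
Variable psi : 'rV[nat]_n -> R.
Hypothesis psi_ge0 : forall q, 0 <= psi q.
Variables (N : nat) (Q : R).
(** Tails are cut along codes, [PsiQ] by the norm; this places the primitive vectors of norm at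
    least [Q] inside the tail. *)
Hypothesis tailQ : forall q : 'rV[nat]_n,
  gcdv q = 1%N -> Q <= `|realv R q| -> (N <= choice.pickle q)%N.
Local Notation MR := (measurableTypeR R).
Local Notation shadow_at := (shadow_at P psi).
Local Notation tail := ([set k | (N <= k)%N]).
Hypothesis tail_lt1 : (\esum_(k in tail) cube_rv (shadow_at k) < 1)%E.

(** The box of q lies in the shadow of its primitive part, and vectors of the same gcd d with the
    same primitive part coincide; hence the finite sum injects into the tail. *)
Lemma fiber_box_sum_le d (p : torus R d 1 m) (B : set 'rV[R]_m) (Y : set 'rV[nat]_n) :
  (0 < d)%N -> p \in P d -> mset B -> finite_set Y -> Y `<=` gcd_fiber Q d ->
  (forall q, Y q -> tbox (d%:R^-1 *: repr p) (psi q / d%:R) `<=` B) ->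
  (\sum_(q \in Y) cube_rv (tbox (d%:R^-1 *: repr p) (psi q / d%:R)) <=
   \esum_(k in tail) cube_rv (shadow_at k `&` B))%E.
Proof.
move=> d0 pP mB finY YF YB.
rewrite -esum_fset//.
have prim q : Y q -> gcdv (primitive_part q) = 1%N by move=> /YF[q0 _ _]; exact: gcdv_primitive_part.
apply: (@le_trans _ _ (\esum_(q in Y) cube_rv (shadow_at (choice.pickle (primitive_part q)) `&` B))%E).
  rewrite -[X in esum X](set_mem_set Y).
  apply: le_esum => q /set_mem Yq; have [q0 qd _] := YF q Yq.
  apply: cube_rv_le.
  - exact: mset_tbox.
  - by apply: measurableI => //; exact: mset_shadow_at.
  - move=> x qx; split; last exact: YB qx.
    rewrite (at_pickle _ _ (prim q Yq)).1; exists d => //; exists p => //.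
    by rewrite (_ : dilate d _ = q)// -[X in dilate X]qd dilate_primitive_part.
rewrite -(esum_image Y (fun q => choice.pickle (primitive_part q)) (fun k => cube_rv (shadow_at k `&` B))).
  apply: sub_esum => _ [q Yq <-] /=; apply: tailQ; first exact: prim.
  have [q0 _] := YF q Yq; rewrite realv_primitive_part scalerA mulVf ?scale1r//.
  by rewrite pnatr_eq0 -lt0n gcdv_gt0.
move=> q q' /set_mem Yq /set_mem Yq' /(pcan_inj choice.pickleK) qq'.
have [_ qd _] := YF q Yq; have [_ qd' _] := YF q' Yq'.
by rewrite -(dilate_primitive_part q) -(dilate_primitive_part q') qq' qd qd'.
Qed.

(* Summability forces 2 psi(q) < d throughout the fibre, so the boxes are not
   truncated and their measures are exactly (2 psi(q) / d)^m. *)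
Lemma PsiQ_radius d : (0 < d)%N -> exists r : R,
  [/\ 0 <= r, PsiQ m psi Q d = r%:E &
   forall p, p \in P d ->
    (cube_rv (tbox (d%:R^-1 *: repr p) (r / d%:R)) <=
     \esum_(k in tail) cube_rv (shadow_at k `&` tbox (d%:R^-1 *: repr p) (r / d%:R)))%E].
Proof.
move=> d0; have dR : 0 < (d%:R : R) by rewrite ltr0n.
have dN0 : (d%:R : R) != 0 by rewrite gt_eqF.
have [p0 p0P] : exists p, p \in P d by apply/fset0Pn; exact: P_neq0.
have psid q : 0 <= psi q / d%:R by rewrite divr_ge0.
(* If 2 psi(q) >= d, the box of q alone has measure 1, more than the whole tail. *)
have small q : gcd_fiber Q d q -> 2 * (psi q / d%:R) < 1.
  move=> Fq; rewrite ltNge; apply/negP => big.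
  have := @fiber_box_sum_le d p0 setT [set q] d0 p0P (@measurableT _ (m.-tuple MR)) (finite_set1 q).
  rewrite fsbig_set1 cube_tbox// min_l// expr1n.
  have : (\esum_(k in tail) cube_rv (shadow_at k `&` setT) < 1)%E.
    by under eq_esum => k _ do rewrite setIT.
  by rewrite ltNge => /negP lt1 h; apply: lt1; apply: h => // q' ->.
have box q p : gcd_fiber Q d q ->
    cube_rv (tbox (d%:R^-1 *: repr p) (psi q / d%:R) : set 'rV[R]_m) =
    ((2 / d%:R) ^+ m * psi q ^+ m)%:E.
  move=> /small/ltW qs; rewrite cube_tbox// min_r// -exprMn.
  by congr (_ ^+ _)%:E; ring.
(* The factor (d/2)^m undoes the scaling between psi(q)^m and the measure (2 psi(q)/d)^m of a
   box. *)
have sum_le p B : p \in P d -> mset B ->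
    (forall q, gcd_fiber Q d q -> tbox (d%:R^-1 *: repr p) (psi q / d%:R) `<=` B) ->
    (\esum_(q in gcd_fiber Q d) (psi q ^+ m)%:E <=
     ((d%:R / 2) ^+ m)%:E * \esum_(k in tail) cube_rv (shadow_at k `&` B))%E.
  move=> pP mB sub; apply: ge_ereal_sup => _ [Y [finY YF] <-].
  rewrite (_ : \sum_(q \in Y) _ = ((d%:R / 2) ^+ m)%:E *
      (((2 / d%:R) ^+ m)%:E * \sum_(q \in Y) (psi q ^+ m)%:E))%E; last first.
    rewrite muleA -EFinM -exprMn (_ : _ * _ = 1); last by field.
    by rewrite expr1n mul1e.
  rewrite lee_wpmul2l ?lee_fin ?exprn_ge0//.
  rewrite ge0_mule_fsumr; last by move=> q; rewrite lee_fin exprn_ge0.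
  apply: le_trans (fiber_box_sum_le d0 pP mB finY YF _); last by move=> q /YF; exact: sub.
  rewrite le_eqVlt; apply/orP; left; apply/eqP; apply: eq_fsbigr => q /set_mem /YF Fq.
  by rewrite box// EFinM.
set s := (\esum_(q in gcd_fiber Q d) (psi q ^+ m)%:E)%E in sum_le *.
have s_ge0 : (0 <= s)%E by apply: esum_ge0 => q _; rewrite lee_fin exprn_ge0.
(* Taking everything for [B] gives s <= (d/2)^m: the sum is finite, and the radius r = s^(1/m) is at
   most d/2, so its box is not truncated either. *)
have s_le : (s <= ((d%:R / 2) ^+ m)%:E)%E.
  apply: le_trans (sum_le p0 setT p0P (@measurableT _ (m.-tuple MR)) _) _ => //.
  rewrite -[leRHS]mule1 lee_wpmul2l ?lee_fin ?exprn_ge0// ltW//.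
  by under eq_esum => k _ do rewrite setIT.
have s_fin : s \is a fin_num by rewrite ge0_fin_numE// (le_lt_trans s_le)// ltry.
have fs0 : 0 <= fine s by exact: fine_ge0.
pose r : R := fine s `^ m%:R^-1.
have r0 : 0 <= r by exact: powR_ge0.
have rm : r ^+ m = fine s.
  rewrite -powR_mulrn// /r -powRrM mulVf ?powRr1//.
  by rewrite pnatr_eq0 -lt0n.
have r_le : 2 * (r / d%:R) <= 1.
  rewrite mulrA ler_pdivrMr// mul1r mulrC -ler_pdivlMr//.
  by rewrite -(@ler_pXn2r _ m)// ?nnegrE ?divr_ge0// rm -lee_fin fineK.
exists r; split => //.
  by rewrite /PsiQ -/s -(fineK s_fin) poweR_EFin.
move=> p pP; rewrite cube_tbox ?divr_ge0// min_r//.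
rewrite (_ : _ ^+ m = (2 / d%:R) ^+ m * fine s); last first.
  by rewrite -rm -exprMn; congr (_ ^+ _); ring.
rewrite EFinM fineK//.
apply: (@le_trans _ _ (((2 / d%:R) ^+ m)%:E * (((d%:R / 2) ^+ m)%:E *
    \esum_(k in tail) cube_rv (shadow_at k `&` tbox (d%:R^-1 *: repr p) (r / d%:R))))%E).
  rewrite lee_wpmul2l ?lee_fin ?exprn_ge0 ?divr_ge0//; apply: (sum_le p) => //; first exact: mset_tbox.
  (* As psi(q)^m is one term of the sum r^m, the box of q lies in the concentric box of radius
     r/d. *)
  move=> q Fq; apply: sub_tbox; rewrite ler_pM2r ?invr_gt0//.
  rewrite -(@ler_pXn2r _ m)// ?nnegrE// rm -lee_fin fineK//.
  apply: ereal_sup_ubound; exists [set q]; last by rewrite fsbig_set1.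
  by split; [exact: finite_set1|move=> q' ->].
rewrite muleA -EFinM -exprMn (_ : _ * _ = 1); last by field.
by rewrite expr1n mul1e.
Qed.

(** Every point of the limsup set lies in some box of radius r_d/d. Finite families of these boxes
    obey [covering_le], with the tail shadows for [T], and the bound passes to their increasing
    union. *)
Lemma leb_W1set_le :
  (leb_torus (W1set P (PsiQ m psi Q)) <=
   (3 ^+ m)%:E * \esum_(k in tail) cube_rv (shadow_at k))%E.
Proof.
have /choice[r hr] : forall d, exists r : R, (0 < d)%N -> [/\ 0 <= r, PsiQ m psi Q d = r%:E &
   forall p, p \in P d ->
    (cube_rv (tbox (d%:R^-1 *: repr p) (r / d%:R)) <=
     \esum_(k in tail) cube_rv (shadow_at k `&` tbox (d%:R^-1 *: repr p) (r / d%:R)))%E].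
  by move=> d; have [/PsiQ_radius[r hr]|d0] := boolP (0 < d)%N; [exists r|exists 0].
pose S : set 'rV[R]_m := [set x | infinite_set [set d | (0 < d)%N /\ approx_set P d (r d) x]].
have mS : mset S.
  by apply: measurable_infinitely_often => d _; exact: mset_approx_set.
have pS : lattice_inv S.
  move=> x Z; rewrite /S/=; split; apply: contra_not; apply: sub_finite_set => d /= [d0 h]; split => //.
    by apply/(lattice_inv_approx_set _ _ _ x Z).
  by apply/(lattice_inv_approx_set _ _ _ x Z).
(* [leb_torus] lives on (1 * m)-tuples and [cube_rv] on m-tuples; the 1 x 1 form [one] identifies
   the two through [cube_linear_preimage]. *)
pose one : 'rV[nat]_1 := const_mx 1%N.
have one1 : realv R one = 1%:M.
  by apply/matrixP => i j; rewrite !ord1 !mxE.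
have -> : leb_torus (W1set P (PsiQ m psi Q)) = cube_rv S.
  rewrite -(@cube_linear_preimage R 1 m one 1%:M)//; last by rewrite one1 mul1mx.
  rewrite leb_torus_cube; congr (cube R _ _); apply/seteqP; split => t;
    rewrite /S/W1set/= one1 mul1mx; apply: contra_not; apply: sub_finite_set => d /= [d0];
    have [_ rd _] := hr d d0.
    by move=> /Aset1_pi; rewrite rd => /(thicken_tbox m_gt0 _ _ _ d0).
  by move=> /(thicken_tbox m_gt0 _ _ _ d0) h; split => //; apply/Aset1_pi; rewrite rd.
pose boxes (M : nat) : seq ('rV[R]_m * R) :=
  flatten [seq [seq (d%:R^-1 *: repr p, r d / d%:R) | p <- P d] | d <- iota 1 M].
have boxesP M a : a \in boxes M ->
    exists d, [/\ (0 < d)%N, (d <= M)%N & exists2 p, p \in P d & a = (d%:R^-1 *: repr p, r d / d%:R)].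
  move=> /flatten_mapP[d]; rewrite mem_iota add1n ltnS => /andP[d0 dM] /mapP[p pP ->].
  by exists d; split => //; exists p.
have mem_boxes M d p : (0 < d)%N -> (d <= M)%N -> p \in P d ->
    (d%:R^-1 *: repr p, r d / d%:R) \in boxes M.
  move=> d0 dM pP; apply/flatten_mapP; exists d; first by rewrite mem_iota add1n ltnS d0.
  by apply/mapP; exists p.
pose E (M : nat) : set 'rV[R]_m := [set x | exists2 a, a \in boxes M & tbox a.1 a.2 x].
have mE M : mset (E M).
  by apply: (cube_rv_exists_le _ (F := fun a => tbox a.1 a.2) _).1 => a; exact: mset_tbox.
have E_le M : (cube_rv (E M) <= (3 ^+ m)%:E * \esum_(k in tail) cube_rv (shadow_at k))%E.
  apply: covering_le => [k|a|a]; first exact: mset_shadow_at.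
    by move=> /boxesP[d [d0 _ [p pP ->]]] /=; have [? _ _] := hr d d0; rewrite divr_ge0.
  by move=> /boxesP[d [d0 _ [p pP ->]]] /=; have [_ _] := hr d d0; exact.
have mUE : measurable (\bigcup_M (@rv_of R m @^-1` E M)) by exact: bigcupT_measurable.
apply: (@le_trans _ _ (cube R m (\bigcup_M (@rv_of R m @^-1` E M)))).
  apply: le_measure; rewrite ?inE// => t /infinite_pickleP/(_ 0)[d [d0 [p pP px]] _].
  by exists d => //; exists (d%:R^-1 *: repr p, r d / d%:R) => //; exact: mem_boxes.
have cvgE : cube R m \o (fun M => @rv_of R m @^-1` E M) @ \oo -->
    cube R m (\bigcup_M (@rv_of R m @^-1` E M)).
  apply: nondecreasing_cvg_mu => // M M' MM'; apply/subsetPset => t.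
  move=> [a /boxesP[d [d0 dM [p pP ->]]] h].
  by exists (d%:R^-1 *: repr p, r d / d%:R) => //; apply: mem_boxes => //; exact: leq_trans MM'.
rewrite -(cvg_lim _ cvgE)//; apply: lime_le; first by apply/cvg_ex; eexists; exact: cvgE.
by apply: nearW => M; exact: E_le.
Qed.

End Convergence.

(** * The dichotomy between divergent and summable shadow masses *)

Lemma Wset_full (R : realType) (m n : nat) (m_gt0 : (0 < m)%N)
    (P : forall d : nat, {fset torus R d 1 m})
    (P_neq0 : forall d : nat, (0 < d)%N -> P d != fset0)
    (psi : 'rV[nat]_n -> R) (psi_ge0 : forall q, 0 <= psi q) :
  (0 < ereal_inf [set leb_torus (W1set P (PsiQ m psi Q)) | Q in [set Q : R | (1 <= Q)%R]])%E ->
  leb_torus (Wset P (fun q => (psi q)%:E)) = 1%E.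
Proof.
set delta := ereal_inf _ => delta0.
pose mass k := cube_rv (shadow_at P psi k).
have mass0 k : (0 <= mass k)%E by exact: measure_ge0.
have [sumoo|sum_lt] := eqVneq (\sum_(k <oo) mass k)%E +oo%E.
  exact: Wset_full_of_divergence.
exfalso; have [e e0 edelta] : exists2 e : R, 0 < e & (e%:E < delta)%E.
  case: delta delta0 => [x| |]//; last by exists 1 => //; exact: ltry.
  by rewrite lte_fin => x0; exists (x / 2); rewrite ?divr_gt0// lte_fin; lra.
(* The bound 1/2 keeps the tail below 1, as [leb_W1set_le] demands; e / 3^m absorbs its covering
   constant. *)
pose eps := Num.min (1 / 2) (e / 3 ^+ m).
have eps0 : 0 < eps by rewrite lt_min !divr_gt0// exprn_gt0.
have [N tailN] : exists N, (\esum_(k in [set k | (N <= k)%N]) mass k < eps%:E)%E.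
  have : (\sum_(N <= k <oo) mass k)%E @[N --> \oo] --> 0%E.
    by apply: nneseries_tail_cvg => //; rewrite ltey.
  move=> /(_ [set x | (x < eps%:E)%E]) [].
    by apply: open_nbhs_nbhs; split; [exact: open_ereal_lt_ereal|rewrite /= lte_fin].
  move=> N _ /(_ N (leqnn N)) /= lteps; exists N; move: lteps; congr (_ < _)%E.
  by rewrite eseries_cond nneseries_esum.
(* [Q] exceeds the norm of each vector with code below [N], so norm at least [Q] forces a code at
   least [N]. The summand 1 makes this strict and ensures Q >= 1. *)
pose Q : R := 1 + \sum_(k < N) if pickle_inv k is Some q then `|realv R (q : 'rV[nat]_n)| else 0.
have tailQ (q : 'rV[nat]_n) : gcdv q = 1%N -> Q <= `|realv R q| -> (N <= choice.pickle q)%N.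
  move=> _; apply: contraTT; rewrite -!ltNge -ltnNge => qN.
  rewrite /Q (bigD1 (Ordinal qN))//= pickleK_inv addrCA ltrDl ltr_pwDl// sumr_ge0// => i _.
  by case: pickle_inv.
have tail_lt1 : (\esum_(k in [set k | (N <= k)%N]) mass k < 1)%E.
  by rewrite (lt_le_trans tailN)// lee_fin ge_min; apply/orP; left; lra.
have := leb_W1set_le m_gt0 P_neq0 psi_ge0 tailQ tail_lt1; apply/negP; rewrite -ltNge.
apply: (@lt_le_trans _ _ delta); last first.
  apply: ereal_inf_lbound; exists Q => //=; rewrite lerDl sumr_ge0// => i _.
  by case: pickle_inv.
apply: le_lt_trans edelta; apply: (@le_trans _ _ ((3 ^+ m)%:E * eps%:E)%E).
  by rewrite lee_wpmul2l ?lee_fin ?exprn_ge0// ltW.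
rewrite -EFinM lee_fin mulrC -ler_pdivlMr ?exprn_gt0//.
by rewrite ge_min lexx orbT.
Qed.

Theorem theorem1p3 (R : realType) (m n : nat) (hm : (0 < m)%N) (hn : (0 < n)%N)
    (P : forall d : nat, {fset torus R d 1 m})
    (P_neq0 : forall d : nat, (0 < d)%N -> P d != fset0)
    (P_card : (fun d : nat => #|` P d|) @ \oo --> \oo) :
  (relatively_well_spread P ->
    forall psi : 'rV[nat]_n -> R, (forall q, 0 <= psi q) ->
      (0 < ereal_inf [set leb_torus (W1set P (PsiQ m psi Q)) |
                        Q in [set Q : R | (1 <= Q)%R]])%E ->
      leb_torus (Wset P (fun q => (psi q)%:E)) = 1%E)
  /\
  (relatively_uniformly_discrete P ->
    forall psi : 'rV[nat]_n -> R, (forall q, 0 <= psi q) ->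
      (exists M : R, forall q, psi q <= M) ->
      (0 < ereal_inf [set leb_torus (W1set P (PsiQ m psi Q)) |
                        Q in [set Q : R | (1 <= Q)%R]])%E ->
      leb_torus (Wset P (fun q => (psi q)%:E)) = 1%E).
Proof.
split=> [_ psi psi_ge0|_ psi psi_ge0 _]; exact: Wset_full.
Qed.
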